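(* Let $I_0>0$, let $T_1>0$, and let $I_1\in C^2([0,T_1];\mathbb{R})$ (i.e. $I_1$ is a $T_1$-periodic function of class $C^2$) satisfy $\int_0^{T_1} I_1(t)\,dt=0$. For any pair $(L,p_z)\in(0,\infty)\times\mathbb{R}$, the period function $T(H)$ of the unperturbed system (defined in the context) is strictly increasing in the Hamiltonian energy $H$ on $(H_0,\infty)$, and $\lim_{H\to\infty}T(H)=\infty$.
   Context: Let $\mu_0>0$ be a fixed constant (vacuum permeability). The unperturbed system (which does not involve $I_1$) is the planar system on $\{(r,p_r): r>0,\ p_r\in\mathbb{R}\}$ $$\dot r=\frac{p_r}{H(r,p_r)},\qquad \dot p_r=\frac{L^2r^{-3}-\frac{\mu_0}{2\pi}I_0r^{-1}\left(p_z+\frac{\mu_0}{2\pi}I_0\ln r\right)}{H(r,p_r)},$$ which is Hamiltonian with energy $$H(r,p_r)=\sqrt{1+\left(p_z+\tfrac{\mu_0}{2\pi}I_0\ln r\right)^2+p_r^2+L^2r^{-2}}.$$ Put $f(r)=1+\left(p_z+\frac{\mu_0}{2\pi}I_0\ln r\right)^2+L^2r^{-2}$ for $r>0$. The function $f$ has a unique minimum point $\bar r$, characterised by $p_z+\frac{\mu_0}{2\pi}I_0\ln\bar r=\frac{2\pi}{\mu_0}\frac{L^2}{I_0}\bar r^{-2}$; the point $(\bar r,0)$ is the unique equilibrium of the system, and $H_0>0$ is defined by $H_0^2=f(\bar r)$. For $H>H_0$, let $r_a=r_a(H)<\bar r<r_b=r_b(H)$ be the two solutions of $f(r)=H^2$.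 The period of the periodic orbit with energy $H$ is $$T(H)=2\int_{r_a}^{r_b}\frac{H}{\sqrt{H^2-f(r)}}\,dr .$$ *)

(* Defs.v *)
(* MathComp-Analysis *)
From HB Require Import structures.
From mathcomp Require Import all_boot all_order all_algebra.
From mathcomp Require Import all_classical all_reals all_analysis.
From mathcomp Require Import ring lra.

Set Implicit Arguments.
Unset Strict Implicit.
Unset Printing Implicit Defensive.

Import Order.TTheory GRing.Theory Num.Theory.
Import numFieldNormedType.Exports.

Local Open Scope classical_set_scope.
Local Open Scope ring_scope.

Definition C2 (R : realType) (u : R -> R) : Prop :=
  [/\ forall t, derivable u t 1,
      forall t, derivable (derive1 u) t 1
    & continuous (derive1n 2 u)].

Section unperturbed_system.
Context {R : realType}.
Variables mu0 I0 L pz : R.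

Definition hamiltonian (r pr : R) : R :=
  Num.sqrt (1 + (pz + mu0 / (2 * pi) * I0 * ln r) ^+ 2
            + pr ^+ 2 + L ^+ 2 * r ^- 2).

(* The function f: the squared energy on the axis [pr = 0], meaningful for
   [0 < r] only (see [hamiltonianE]). *)
Definition energy2 (r : R) : R :=
  1 + (pz + mu0 / (2 * pi) * I0 * ln r) ^+ 2 + L ^+ 2 * r ^- 2.

(* [rbar], [turn_in] and [turn_out] are definite descriptions; for positive
   [mu0], [I0], [L] (and [H > H0]) existence and uniqueness are given by
   [rbarP]/[rbar_unique], [turn_inP]/[turn_in_unique] and
   [turn_outP]/[turn_out_unique]. *)
Definition rbar : R :=
  get [set r : R | 0 < r /\ forall s, 0 < s -> energy2 r <= energy2 s].

Definition H0 : R := Num.sqrt (energy2 rbar).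

Definition turn_in (H : R) : R :=
  get [set r : R | 0 < r < rbar /\ energy2 r = H ^+ 2].

Definition turn_out (H : R) : R :=
  get [set r : R | rbar < r /\ energy2 r = H ^+ 2].

(* On the level set of energy [H] one has [pr ^+ 2 = H ^+ 2 - energy2 r] and
   the equation of motion r' = pr / H, so the half orbit [pr > 0] takes time
   [\int H / sqrt (H ^+ 2 - energy2 r)] between the turning points. The
   integrand blows up there: the integral is a Lebesgue integral with values in
   [\bar R], so no finiteness is presupposed. *)
Definition period (H : R) : \bar R :=
  (2%:E * \int[lebesgue_measure]_(r in `]turn_in H, turn_out H[)
            (H / Num.sqrt (H ^+ 2 - energy2 r))%:E)%E.

Lemma hamiltonianE r pr :
  hamiltonian r pr = Num.sqrt (energy2 r + pr ^+ 2).
Proof. by rewrite /hamiltonian /energy2 addrAC. Qed.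

Hypothesis mu0_gt0 : 0 < mu0.
Hypothesis I0_gt0 : 0 < I0.
Hypothesis L_gt0 : 0 < L.

Local Notation k := (mu0 / (2 * pi) * I0).

Let k_gt0 : 0 < k.
Proof. by rewrite mulr_gt0// divr_gt0// mulr_gt0// pi_gt0. Qed.

(* [r / 2] times the derivative of [energy2] *)
Let slope (r : R) : R := k * (pz + k * ln r) - L ^+ 2 * r ^- 2.

Let invsqE (r : R) : 0 < r -> r ^- 2 = expR (- (2 * ln r)).
Proof.
move=> r0; rewrite expRN expRM_natl lnK//.
Qed.

Let energy2_gap (r s : R) : 0 < r -> 0 < s ->
  2 * slope r * (ln s - ln r) + k ^+ 2 * (ln s - ln r) ^+ 2
    <= energy2 s - energy2 r.
Proof.
move=> r0 s0; set d := ln s - ln r.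
have e : s ^- 2 = r ^- 2 * expR (- (2 * d)).
  by rewrite !invsqE// -expRD; congr expR; rewrite /d; ring.
have c0 : 0 <= L ^+ 2 * r ^- 2 by rewrite mulr_ge0// ?invr_ge0 exprn_ge0// ltW.
have h : 0 <= (L ^+ 2 * r ^- 2) * (expR (- (2 * d)) - (1 - 2 * d)).
  by rewrite mulr_ge0// subr_ge0 expR_ge1Dx.
rewrite /energy2 /slope e; have -> : ln s = ln r + d by rewrite /d; ring.
nra.
Qed.

Let slope_continuous (r : R) : 0 < r -> {for r, continuous slope}.
Proof.
move=> r0; apply: cvgB.
  by apply: cvgM; [exact: cvg_cst|apply: cvgD; [exact: cvg_cst|
    apply: cvgM; [exact: cvg_cst|exact: continuous_ln]]].
apply: cvgM; first exact: cvg_cst.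
apply: cvgV; first by rewrite expf_neq0// gt_eqF.
exact: exprn_continuous.
Qed.

Let energy2_continuous (r : R) : 0 < r -> {for r, continuous energy2}.
Proof.
move=> r0; apply: cvgD.
  apply: cvgD; first exact: cvg_cst.
  by apply: cvgM; (apply: cvgD; [exact: cvg_cst|
    apply: cvgM; [exact: cvg_cst|exact: continuous_ln]]).
apply: cvgM; first exact: cvg_cst.
apply: cvgV; first by rewrite expf_neq0// gt_eqF.
exact: exprn_continuous.
Qed.

Let within_pos (g : R -> R) (a b : R) : 0 < a ->
  (forall r, 0 < r -> {for r, continuous g}) -> {within `[a, b], continuous g}.
Proof.
move=> a0 cg; apply: continuous_in_subspaceT => x; rewrite inE/= in_itv/=.
by move=> /andP[ax _]; apply: cg; exact: lt_le_trans ax.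
Qed.

Let slope_incr (r s : R) : 0 < r -> r < s -> slope r < slope s.
Proof.
move=> r0 rs; have s0 := lt_trans r0 rs.
have : ln r < ln s by rewrite ltr_ln.
have : s ^- 2 <= r ^- 2.
  by rewrite lef_pV2 ?posrE ?exprn_gt0// lerXn2r ?nnegrE ?ltW.
move=> h1 h2; rewrite /slope.
apply: ltr_leB; first by rewrite ltr_pM2l// ltrD2l ltr_pM2l.
by rewrite ler_wpM2l// exprn_ge0// ltW.
Qed.

Let slope_zero : exists2 r, 0 < r & slope r = 0.
Proof.
pose a := expR (Order.min 0 (- pz / k)).
pose b := expR (Order.max 0 ((L ^+ 2 / k - pz) / k)).
have a0 : 0 < a by exact: expR_gt0.
have b0 : 0 < b by exact: expR_gt0.
have L20 : 0 < L ^+ 2 by rewrite exprn_gt0.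
have sa : slope a <= 0.
  rewrite /slope /a expRK subr_le0.
  have h : pz + k * Order.min 0 (- pz / k) <= 0.
    have : k * Order.min 0 (- pz / k) <= k * (- pz / k).
      by rewrite ler_pM2l// ge_min lexx orbT.
    by rewrite [k * (_ / _)]mulrC divfK ?gt_eqF//; lra.
  apply: (@le_trans _ _ 0); first by rewrite pmulr_rle0//.
  by rewrite mulr_ge0 ?invr_ge0 ?sqr_ge0.
have sb : 0 <= slope b.
  rewrite /slope {1}/b expRK subr_ge0.
  have h : L ^+ 2 / k <= pz + k * Order.max 0 ((L ^+ 2 / k - pz) / k).
    have : k * ((L ^+ 2 / k - pz) / k) <=
           k * Order.max 0 ((L ^+ 2 / k - pz) / k).
      by rewrite ler_pM2l// le_max lexx orbT.
    by rewrite [k * (_ / _)]mulrC divfK ?gt_eqF//; lra.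
  apply: (@le_trans _ _ (L ^+ 2)).
    rewrite ler_piMr ?(ltW L20)// invf_le1 ?exprn_gt0// exprn_ege1// /b.
    by rewrite -expR0 ler_expR le_max lexx.
  by rewrite -ler_pdivrMl// mulrC.
have ab : a <= b.
  by rewrite leNgt; apply/negP => /(slope_incr b0); rewrite ltNge (le_trans sa sb).
have [||r + r0] := @IVT _ slope a b 0 ab.
- exact: within_pos.
- by rewrite ge_min le_max sa sb orbT.
- by rewrite in_itv/= => /andP[ar _]; exists r => //; exact: lt_le_trans ar.
Qed.

Let slope0_min (r s : R) : 0 < r -> slope r = 0 -> 0 < s -> s != r ->
  energy2 r < energy2 s.
Proof.
move=> r0 sr s0 nrs; rewrite -subr_gt0.
apply: lt_le_trans (energy2_gap r0 s0).
rewrite sr mulr0 mul0r add0r mulr_gt0 ?(exprn_gt0 2 k_gt0)// exprn_even_gt0//=.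
rewrite subr_eq0; apply: contra nrs => /eqP e; apply/eqP.
by apply: ln_inj; rewrite ?posrE.
Qed.

Lemma rbarP : 0 < rbar /\ forall s, 0 < s -> energy2 rbar <= energy2 s.
Proof.
apply: (@xgetPex _ point
  [set r : R | 0 < r /\ forall s, 0 < s -> energy2 r <= energy2 s]).
have [r r0 sr] := slope_zero; exists r; split => // s s0.
have [->//|nrs] := eqVneq s r.
exact/ltW/slope0_min.
Qed.

Lemma rbar_unique r :
  0 < r -> (forall s, 0 < s -> energy2 r <= energy2 s) -> r = rbar.
Proof.
have [z z0 sz] := slope_zero.
have main x : 0 < x -> (forall s, 0 < s -> energy2 x <= energy2 s) -> x = z.
  move=> x0 xmin; apply/eqP/negP => /negP xz.
  by have := slope0_min z0 sz x0 xz; rewrite ltNge xmin.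
by move=> r0 rm; have [p0 pm] := rbarP; rewrite (main _ r0 rm) (main _ p0 pm).
Qed.

Let slope_rbar : slope rbar = 0.
Proof.
have [z z0 sz] := slope_zero; rewrite -(rbar_unique z0)// => s s0.
by have [->//|nrs] := eqVneq s z; exact/ltW/slope0_min.
Qed.

Lemma rbarE :
  pz + mu0 / (2 * pi) * I0 * ln rbar = 2 * pi / mu0 * (L ^+ 2 / I0) * rbar ^- 2.
Proof.
have /eqP := slope_rbar; rewrite /slope subr_eq0 => /eqP e.
have p0 : pi != 0 :> R by rewrite gt_eqF// pi_gt0.
apply: (@mulfI _ k); first by rewrite gt_eqF.
rewrite e; move: (pi) p0 => p p0; field.
by have [q0 _] := rbarP; rewrite p0 !gt_eqF.
Qed.

Let energy2_incr (r s : R) : rbar <= r -> r < s -> energy2 r < energy2 s.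
Proof.
have [p0 _] := rbarP.
move=> pr rs; have r0 := lt_le_trans p0 pr; have s0 := lt_trans r0 rs.
have d0 : 0 < ln s - ln r by rewrite subr_gt0 ltr_ln.
have h : 0 <= slope r.
  have [<-|nr] := eqVneq rbar r; first by rewrite slope_rbar.
  by rewrite -slope_rbar ltW// slope_incr// lt_neqAle nr.
rewrite -subr_gt0; apply: lt_le_trans (energy2_gap r0 s0).
have g : 0 < k ^+ 2 * (ln s - ln r) ^+ 2 by rewrite mulr_gt0// exprn_gt0.
have g' : 0 <= slope r * (ln s - ln r) by rewrite mulr_ge0// ltW.
by rewrite -mulrA; lra.
Qed.

Let energy2_decr (s r : R) : 0 < s -> s < r -> r <= rbar ->
  energy2 r < energy2 s.
Proof.
move=> s0 sr rp; have r0 := lt_trans s0 sr.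
have d0 : 0 < ln r - ln s by rewrite subr_gt0 ltr_ln.
have h : slope r <= 0.
  have [->|nr] := eqVneq r rbar; first by rewrite slope_rbar.
  by rewrite -slope_rbar ltW// slope_incr// lt_neqAle nr.
rewrite -subr_gt0; apply: lt_le_trans (energy2_gap r0 s0).
have g : 0 < k ^+ 2 * (ln s - ln r) ^+ 2.
  by rewrite mulr_gt0 ?(exprn_gt0 2 k_gt0)// -opprB sqrrN exprn_gt0.
have g' : 0 <= slope r * (ln s - ln r) by rewrite mulr_le0//; lra.
by rewrite -mulrA; lra.
Qed.

Lemma H0_gt0 : 0 < H0.
Proof.
rewrite /H0 sqrtr_gt0 /energy2 -addrA ltr_pwDl// addr_ge0 ?sqr_ge0//.
by rewrite mulr_ge0 ?invr_ge0 ?sqr_ge0.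
Qed.

Lemma H0_sqr : H0 ^+ 2 = energy2 rbar.
Proof. by rewrite sqr_sqrtr// ltW// -sqrtr_gt0 H0_gt0. Qed.

Let energy2_rbar_lt (H : R) : H0 < H -> energy2 rbar < H ^+ 2.
Proof.
by move=> h; rewrite -H0_sqr ltr_pXn2r ?nnegrE ?(ltW H0_gt0)// ltW// (lt_trans H0_gt0).
Qed.

Lemma turn_inP H : H0 < H ->
  0 < turn_in H < rbar /\ energy2 (turn_in H) = H ^+ 2.
Proof.
move=> HH; apply: (@xgetPex _ point
  [set r : R | 0 < r < rbar /\ energy2 r = H ^+ 2]).
have [p0 _] := rbarP; have h := energy2_rbar_lt HH.
have Hp : 0 < H by exact: lt_trans H0_gt0 HH.
pose a := Order.min rbar (L / H).
have a0 : 0 < a by rewrite lt_min p0 divr_gt0.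
have ap : a <= rbar by rewrite ge_min lexx.
have fa : H ^+ 2 <= energy2 a.
  have : H ^+ 2 <= L ^+ 2 * a ^- 2.
    rewrite ler_pdivlMr ?exprn_gt0// -exprMn lerXn2r ?nnegrE ?(ltW L_gt0)//.
      by rewrite mulr_ge0 ?ltW.
    by rewrite -ler_pdivlMl// [_^-1 * _]mulrC ge_min lexx orbT.
  by move=> /le_trans; apply; rewrite ler_wpDl// addr_ge0 ?sqr_ge0.
have [||r + fr] := @IVT _ energy2 a rbar (H ^+ 2) ap.
- exact: within_pos.
- by rewrite ge_min le_max fa (ltW h) orbT.
rewrite in_itv/= => /andP[ar rp]; exists r; split => //.
rewrite (lt_le_trans a0 ar) lt_neqAle rp andbT.
by apply: contraTneq h => <-; rewrite fr ltxx.
Qed.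

Lemma turn_in_unique H r : H0 < H ->
  0 < r < rbar -> energy2 r = H ^+ 2 -> r = turn_in H.
Proof.
move=> /turn_inP[/andP[t0 tp] ft] /andP[r0 rp] fr.
have [c|c|//] := ltgtP r (turn_in H).
- by have := energy2_decr r0 c (ltW tp); rewrite fr ft ltxx.
- by have := energy2_decr t0 c (ltW rp); rewrite fr ft ltxx.
Qed.

Lemma turn_outP H : H0 < H ->
  rbar < turn_out H /\ energy2 (turn_out H) = H ^+ 2.
Proof.
move=> HH; apply: (@xgetPex _ point
  [set r : R | rbar < r /\ energy2 r = H ^+ 2]).
have [p0 _] := rbarP; have h := energy2_rbar_lt HH.
have Hp : 0 < H by exact: lt_trans H0_gt0 HH.
pose b := Order.max rbar (expR ((H - pz) / k)).
have b0 : 0 < b by rewrite lt_max p0.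
have pb : rbar <= b by rewrite le_max lexx.
have fb : H ^+ 2 <= energy2 b.
  have lb : (H - pz) / k <= ln b.
    by rewrite -[leLHS]expRK ler_ln ?posrE ?expR_gt0// le_max lexx orbT.
  have : H <= pz + k * ln b.
    by move: lb; rewrite ler_pdivrMr// mulrC; lra.
  move=> hb; have : H ^+ 2 <= (pz + k * ln b) ^+ 2.
    by rewrite lerXn2r ?nnegrE// ltW// (lt_le_trans Hp).
  have c0 : 0 <= L ^+ 2 * b ^- 2 by rewrite mulr_ge0 ?invr_ge0 ?sqr_ge0.
  by rewrite /energy2; lra.
have [||r + fr] := @IVT _ energy2 rbar b (H ^+ 2) pb.
- exact: within_pos.
- by rewrite ge_min le_max fb (ltW h) orbT.
rewrite in_itv/= => /andP[pr rb]; exists r; split => //.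
rewrite lt_neqAle pr andbT.
by apply: contraTneq h => ->; rewrite fr ltxx.
Qed.

Lemma turn_out_unique H r : H0 < H ->
  rbar < r -> energy2 r = H ^+ 2 -> r = turn_out H.
Proof.
move=> /turn_outP[tp ft] rp fr.
have [c|c|//] := ltgtP r (turn_out H).
- by have := energy2_incr (ltW rp) c; rewrite fr ft ltxx.
- by have := energy2_incr (ltW tp) c; rewrite fr ft ltxx.
Qed.

End unperturbed_system.

(* Main.v *)
Require Import Defs.
From HB Require Import structures.
From mathcomp Require Import all_boot all_order all_algebra.
From mathcomp Require Import all_classical all_reals all_analysis.
From mathcomp Require Import measurable_realfun ring lra.

Set Implicit Arguments.
Unset Strict Implicit.
Unset Printing Implicit Defensive.

Import Order.TTheory GRing.Theory Num.Theory.
Import numFieldNormedType.Exports.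

Local Open Scope classical_set_scope.
Local Open Scope ring_scope.

(* Put u = ln (r / rbar) and h = sqrt (H^2 - H0^2) / k with k = mu0 I0 / (2 pi).
   The well becomes W(u) = u^2 + b (exp (-2u) - 1 + 2u), and the period is
   (2 H / k) times I(h) / h, where I(h) is the integral of h / sqrt (h^2 - W) dr
   between the turning points. As H is increasing, it suffices that I(h) / h is
   nondecreasing and finite.

   Let w(h) be the distance between the turning points. By the layer cake
   formula I(h) is the integral over y > 0 of w(h) - w(t h), with
   t = sqrt (max (0, 1 - 1/y^2)), so everything follows from convexity of w:
   it makes (w(h) - w(t h)) / h nondecreasing, and bounds w(h) - w(t h) by
   (1 - t) (w(2h) - w(h)).

   Convexity of w is a property of r = exp u as a function of the signed square
   root h of W: its second derivative is at least its value at h = 0 for h > 0,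
   and at most that value for h < 0. This is an elementary inequality between
   exponential polynomials in u. *)

(** * Differentiation rules and a sign criterion *)

Section derivative_rules.
Context {R : realType}.
Implicit Types (f g : R -> R) (x a b c : R).

(** These rules spell functions out pointwise, the shape in which [derive_rules] meets them. *)
Lemma is_derive_add f g x a b : is_derive x 1 f a -> is_derive x 1 g b ->
  is_derive x 1 (fun y => f y + g y) (a + b).
Proof. by move=> df dg; exact: is_deriveD. Qed.

Lemma is_derive_opp f x a : is_derive x 1 f a ->
  is_derive x 1 (fun y => - f y) (- a).
Proof. by move=> df; exact: is_deriveN. Qed.

Lemma is_derive_mul f g x a b : is_derive x 1 f a -> is_derive x 1 g b ->
  is_derive x 1 (fun y => f y * g y) (a * g x + f x * b).
Proof.
move=> df dg; have := is_deriveM df dg.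
by rewrite /GRing.scale/= addrC [g x * a]mulrC.
Qed.

Lemma is_derive_const c x : is_derive x 1 (fun=> c) 0.
Proof. exact: is_derive_cst. Qed.

Lemma is_derive_ident x : is_derive x 1 (fun y : R => y) 1.
Proof. exact: is_derive_id. Qed.

Lemma is_derive_exp f x a : is_derive x 1 f a ->
  is_derive x 1 (fun y => expR (f y)) (a * expR (f x)).
Proof.
by move=> df; rewrite mulrC; exact: (is_derive1_comp (is_derive_expR _) df).
Qed.

Lemma is_derive_continuous f x a : is_derive x 1 f a -> {for x, continuous f}.
Proof. by move=> [/derivable1_diffP/differentiable_continuous]. Qed.

(** Reduces the inequalities below to their derivatives, each time with value 0 at the origin, until
    the sign is elementary. *)
Lemma ge0_of_derive f df : (forall x, is_derive x 1 f (df x)) -> f 0 = 0 ->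
  (forall x, 0 < x -> 0 <= df x) -> forall x, 0 <= x -> 0 <= f x.
Proof.
move=> fdf f0 df0 x; rewrite le_eqVlt => /predU1P[<-|x0]; first by rewrite f0.
have [|c] := MVT x0 (fun y _ => fdf y).
  apply: derivable_within_continuous => y _.
  exact: (@ex_derive _ _ _ _ _ _ _ (fdf y)).
rewrite in_itv/= f0 !subr0 => /andP[c0 _] ->.
by rewrite mulr_ge0 ?df0 ?ltW.
Qed.

End derivative_rules.

Ltac derive_rules := repeat (first
  [ apply: is_derive_const | apply: is_derive_ident | apply: is_derive_add
  | apply: is_derive_opp | apply: is_derive_mul | apply: is_derive_exp ]).

(** * Inequalities between exponential polynomials *)

Section exponential_inequalities.
Context {R : realType}.
Implicit Types u : R.

Lemma sinh_lb u : 0 <= u -> 2 * u <= expR u - expR (- u).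
Proof.
move=> u0; rewrite -subr_ge0.
pose df (x : R) := expR x + expR (- x) - 2.
apply: (@ge0_of_derive _ (fun x => expR x - expR (- x) - 2 * x) df) u0 => [x||x x0].
- apply: is_derive_eq; first derive_rules.
  by rewrite /df /GRing.scale/=; ring.
- by rewrite oppr0 expR0; ring.
- by rewrite /df; have := expR_ge1Dx x; have := expR_ge1Dx (- x); lra.
Qed.

(** Divided by [expR u], this is [1 - expR (- (2 * u)) <= 2 * u], whatever the sign of [u]. *)
Lemma sinh_ub u : expR u - expR (- u) <= 2 * u * expR u.
Proof.
have e0 := expR_gt0 u.
have e1 : expR (- u) = expR u * expR (- (2 * u)).
  by rewrite -expRD; congr expR; ring.
have := expR_ge1Dx (- (2 * u)); rewrite e1; nra.
Qed.

Lemma cosh_sinh_lb u : 0 <= u ->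
  u ^+ 3 * (2 / 3) <= u * (expR u + expR (- u)) - (expR u - expR (- u)).
Proof.
move=> u0; rewrite -subr_ge0 (_ : u ^+ 3 = u * u * u); last by ring.
pose df (x : R) := x * (expR x - expR (- x) - 2 * x).
apply: (@ge0_of_derive _ (fun x => x * (expR x + expR (- x)) -
  (expR x - expR (- x)) - x * x * x * (2 / 3)) df) => [x||x x0|//].
- apply: is_derive_eq; first derive_rules.
  by rewrite /df /GRing.scale/=; field.
- by rewrite oppr0 expR0; ring.
- by rewrite /df; have := sinh_lb (ltW x0); nra.
Qed.

(** The difference has derivative [u / 3] times the left-hand side, which [cosh_sinh_lb] makes
    nonnegative. *)
Lemma cosh_sinh_ub u : 0 <= u ->
  u * (expR u + expR (- u)) - (expR u - expR (- u)) <=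
  u ^+ 2 / 3 * (expR u - expR (- u)).
Proof.
move=> u0; rewrite -subr_ge0 (_ : u ^+ 2 = u * u); last by ring.
pose df (x : R) := x / 3 * (x * (expR x + expR (- x)) - (expR x - expR (- x))).
apply: (@ge0_of_derive _ (fun x => x * x / 3 * (expR x - expR (- x)) -
  (x * (expR x + expR (- x)) - (expR x - expR (- x)))) df) => [x||x x0|//].
- apply: is_derive_eq; first derive_rules.
  by rewrite /df /GRing.scale/=; field.
- by rewrite oppr0 expR0; ring.
- rewrite /df mulr_ge0 ?divr_ge0 ?(ltW x0)//.
  apply: le_trans (cosh_sinh_lb (ltW x0)).
  by rewrite mulr_ge0 ?divr_ge0 ?exprn_ge0// ltW.
Qed.

Let expR2 u : expR (2 * u) = expR u ^+ 2.
Proof. by rewrite expRM_natl. Qed.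

Let expRN2 u : expR (- (2 * u)) = expR (- u) ^+ 2.
Proof. by rewrite -mulrN expRM_natl. Qed.

Let expRNK u : expR u * expR (- u) = 1.
Proof. exact: expRxMexpNx_1. Qed.

(** Times [8 * expR (- u)], this is the coefficient [c2] in [curvature_bound_right]. The expression
    and its first derivative vanish at 0, so the sign of the second derivative decides. *)
Lemma right_quadratic_ge0 u : 0 <= u ->
  0 <= 1 - expR (- (2 * u)) + u * (expR (2 * u) - 3)
       - 5 / 3 * u ^+ 2 * (expR u - expR (- u)).
Proof.
move=> u0; rewrite (_ : u ^+ 2 = u * u); last by ring.
pose d1 (x : R) := 2 * expR (- (2 * x)) + expR (2 * x) * (1 + 2 * x) - 3
  - 10 / 3 * x * (expR x - expR (- x)) - 5 / 3 * (x * x) * (expR x + expR (- x)).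
apply: (@ge0_of_derive _ (fun u => 1 - expR (- (2 * u)) + u * (expR (2 * u) - 3)
       - 5 / 3 * (u * u) * (expR u - expR (- u))) d1) => [x||{u u0} u u0|//].
- apply: is_derive_eq; first derive_rules.
  by rewrite /d1 /GRing.scale/=; field.
- by rewrite !mulr0 oppr0 expR0; ring.
pose d2 (x : R) := - 4 * expR (- (2 * x)) + expR (2 * x) * (4 + 4 * x)
  - 10 / 3 * (expR x - expR (- x)) - 20 / 3 * x * (expR x + expR (- x))
  - 5 / 3 * (x * x) * (expR x - expR (- x)).
apply: (@ge0_of_derive _ d1 d2) (ltW u0) => [x||{u u0} u u0].
- apply: is_derive_eq; first (unfold d1; derive_rules).
  by rewrite /d2 /GRing.scale/=; field.
- by rewrite /d1 !mulr0 oppr0 expR0; ring.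
have S := sinh_lb (ltW u0).
rewrite /d2 expRN2 expR2.
have E1 := expR_ge1Dx u; have EF := expRNK u; have F0 := expR_gt0 (- u).
move: (expR u) (expR (- u)) S E1 EF F0 => E F S E1 EF F0.
have C2 : 2 <= E + F by nra.
(* After [s3] is paid from [4 * u * E ^+ 2], the remaining [4 * u * E] lowers the coefficient of
   [u * (E + F)] from 20/3 to 14/3. Then [s1] and [s2] use 7/3 and 5/3 of the available
   [4 * (E ^+ 2 - F ^+ 2)]. *)
have s1 : 14 / 3 * (2 * u * (E + F)) <= 14 / 3 * ((E - F) * (E + F)) by nra.
have s2 : (E - F) * 2 <= (E - F) * (E + F) by nra.
have s3 : 5 / 3 * u * (u * (E - F)) <= u * (4 * E ^+ 2 - 4 * E).
  rewrite [leLHS](_ : _ = u * (5 / 3 * (u * (E - F)))); last by ring.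
  have uF : 0 <= u * F by rewrite mulr_ge0 ?ltW.
  have uE : u * E <= (E - 1) * E by rewrite ler_wpM2r; lra.
  have uE0 : 0 <= u * E by rewrite mulr_ge0; lra.
  by rewrite ler_wpM2l ?(ltW u0)//; lra.
have s4 : 0 <= E - F by lra.
nra.
Qed.

(** Times [8 * expR u], this bounds the coefficient [c2] in [curvature_bound_left] from below. *)
Lemma left_quadratic_ge0 u : 0 <= u ->
  0 <= (5 / 3 * u ^+ 2 - 1) * (expR (2 * u) - 1) + u * (3 - expR (- (2 * u))).
Proof.
move=> u0; rewrite (_ : u ^+ 2 = u * u); last by ring.
pose d1 (x : R) := 10 / 3 * x * (expR (2 * x) - 1)
  + (10 / 3 * (x * x) - 2) * expR (2 * x) + 3
  - expR (- (2 * x)) + 2 * x * expR (- (2 * x)).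
apply: (@ge0_of_derive _ (fun u => (5 / 3 * (u * u) - 1) * (expR (2 * u) - 1)
   + u * (3 - expR (- (2 * u)))) d1) => [x||{u u0} u u0|//].
- apply: is_derive_eq; first derive_rules.
  by rewrite /d1 /GRing.scale/=; field.
- by rewrite !mulr0 oppr0 expR0; ring.
pose d2 (x : R) := expR (2 * x) * (20 / 3 * (x * x) + 40 / 3 * x - 2 / 3)
  - 10 / 3 + (4 - 4 * x) * expR (- (2 * x)).
apply: (@ge0_of_derive _ d1 d2) (ltW u0) => [x||{u u0} u u0].
- apply: is_derive_eq; first (unfold d1; derive_rules).
  by rewrite /d2 /GRing.scale/=; field.
- by rewrite /d1 !mulr0 oppr0 expR0; ring.
rewrite /d2.
have G1 := expR_ge1Dx (2 * u); have H1 := expR_ge1Dx (- (2 * u)).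
have GH := expRNK (2 * u); have H0 := expR_gt0 (- (2 * u)).
move: (expR (2 * u)) (expR (- (2 * u))) G1 H1 GH H0 => G H G1 H1 GH H0.
have H2 : H <= 1 by nra.
have G0 : 0 < G by lra.
have G2 : G * (1 - 2 * u) <= 1 by nra.
(* The two linear bounds are matched: four times [s1] plus [s2] cancels [- 10 / 3] and leaves
   [20 / 3 * u ^+ 2 * G]. *)
have s1 : 1 - 3 * u <= H * (1 - u).
  by have [u1|u1] := leP u 1; nra.
have s2 : - (2 / 3) + 12 * u <= G * (40 / 3 * u - 2 / 3).
  (* The factor of [G] changes sign at 1/20: [G] is bounded below by [G1] beyond it, and above by
     [G2] before it. *)
  have [u1|u1] := leP (1 / 20) u; first by nra.
  nra.
nra.
Qed.

End exponential_inequalities.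

(** * The scaled potential and its curvature inequality *)

Section scaled_potential.
Context {R : realType}.
Implicit Types b u v : R.

(* Up to a constant factor this is [energy2 r - H0 ^+ 2] at
   [u = ln (r / rbar)], see [energy2_potential]. *)
Definition potential b u : R := u ^+ 2 + b * (expR (- (2 * u)) - 1 + 2 * u).

Definition dpotential b u : R := 2 * u + 2 * b * (1 - expR (- (2 * u))).

Definition d2potential b u : R := 2 + 4 * b * expR (- (2 * u)).

(* The value at 0 of the second derivative of [expR u] with respect to the
   signed square root of [potential b u]. *)
Definition curvature b : R := (3 + 10 * b) / (3 * (1 + 2 * b) ^+ 2).

(* The difference of the two sides has the sign of the derivative of [slope]
   below. Two of the three factors [dpotential b u] are first bounded so that the
   denominator of [curvature b] cancels up to a factor linear in [b]; then every
   coefficient of the difference, a polynomial of degree 2 in [b], is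
   nonnegative. *)
Lemma curvature_bound_right b u : 0 <= b -> 0 <= u ->
  curvature b * dpotential b u ^+ 3 <=
  2 * expR u * (2 * potential b u * dpotential b u + dpotential b u ^+ 2
                - 2 * potential b u * d2potential b u).
Proof.
move=> b0 u0.
have S := sinh_lb u0; have CS := cosh_sinh_ub u0.
have Q := right_quadratic_ge0 u0; have E1 := expR_ge1Dx u.
have e2 : expR (- (2 * u)) = expR (- u) ^+ 2 by rewrite -mulrN expRM_natl.
have h1 := expR_ge1Dx (- (2 * u)).
have EF := expRxMexpNx_1 u; have F0 := expR_gt0 (- u).
rewrite /potential /dpotential /d2potential.
rewrite (expRM_natl 2 u) in Q.
move: Q h1 EF F0 CS S E1; rewrite e2; move: (expR u) (expR (- u)) => E F.
move=> Q h1 EF F0 CS S E1.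
have E0 : 0 < E by lra.
have EF2 : E * F ^+ 2 = F by rewrite expr2 mulrA EF mul1r.
have F1 : F <= 1 by nra.
have F21 : F ^+ 2 <= 1 by nra.
have D0 : 0 <= 2 * u + 2 * b * (1 - F ^+ 2).
  by rewrite addr_ge0 ?mulr_ge0//; lra.
have D1 : 2 * u + 2 * b * (1 - F ^+ 2) <= 2 * u * (1 + 2 * b).
  by have := ler_wpM2l b0 h1; lra.
have B0 : 0 < (1 + 2 * b) ^+ 2 by rewrite exprn_gt0//; lra.
have K : curvature b * (2 * u + 2 * b * (1 - F ^+ 2)) ^+ 3 <=
    4 * u ^+ 2 * (1 + 10 / 3 * b) * (2 * u + 2 * b * (1 - F ^+ 2)).
  rewrite exprSr mulrA ler_wpM2r//.
  have -> : 4 * u ^+ 2 * (1 + 10 / 3 * b) =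
      curvature b * (2 * u * (1 + 2 * b)) ^+ 2.
    by rewrite /curvature; field; lra.
  rewrite ler_wpM2l ?lerXn2r ?nnegrE//; last by lra.
  by rewrite /curvature divr_ge0 ?mulr_ge0 ?(ltW B0)//; lra.
apply: le_trans K _.
(* [c0], [c1], [c2] concern the coefficients of 1, [b], [b ^+ 2] in half the difference, simplified
   by [E * F = 1]. *)
have c0 : 0 <= 4 * u ^+ 3 * (E - 1) by rewrite !mulr_ge0 ?exprn_ge0//; lra.
have u20 : 0 <= u ^+ 2 by rewrite exprn_ge0.
(* Of the 12 units of [u ^+ 2 * (E - F)], [CS] uses 4/3, [dE] uses 4 and [S] the remaining 20/3. *)
have c1 : 0 <= 12 * u ^+ 2 * (E - F) - 4 * u * (E + F) + 4 * (E - F)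
    - 4 * u ^+ 2 * (1 - F ^+ 2 + 10 / 3 * u).
  have dE : 1 - F ^+ 2 <= E - F.
    have -> : 1 - F ^+ 2 = F * (E - F) by rewrite mulrBr [F * E]mulrC EF.
    by rewrite ler_piMl//; lra.
  have := ler_wpM2l u20 dE; have := ler_wpM2l u20 S; lra.
have c2 : 0 <= 8 * (F * (1 - F ^+ 2 + u * (E ^+ 2 - 3)))
    - 40 / 3 * u ^+ 2 * (1 - F ^+ 2).
  have -> : 1 - F ^+ 2 = F * (E - F) by rewrite mulrBr [F * E]mulrC EF.
  have := mulr_ge0 (ltW F0) Q.
  have -> : 1 - F ^+ 2 = F * (E - F) by rewrite mulrBr [F * E]mulrC EF.
  by lra.
rewrite -subr_ge0.
rewrite [X in 0 <= X](_ : _ = 2 * (4 * u ^+ 3 * (E - 1)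
  + b * (12 * u ^+ 2 * (E - E * F ^+ 2) - 4 * u * (E + E * F ^+ 2)
         + 4 * (E - E * F ^+ 2) - 4 * u ^+ 2 * (1 - F ^+ 2 + 10 / 3 * u))
  + b ^+ 2 * (8 * (E * F ^+ 2 * (1 - F ^+ 2) + u * (E - 3 * (E * F ^+ 2)))
         - 40 / 3 * u ^+ 2 * (1 - F ^+ 2)))); last by field.
have FE2 : F * E ^+ 2 = E by rewrite expr2 mulrA [F * E]mulrC EF mul1r.
rewrite EF2 mulr_ge0// addr_ge0//.
  by rewrite addr_ge0// mulr_ge0.
rewrite mulr_ge0 ?sqr_ge0//.
have -> : F * (1 - F ^+ 2) + u * (E - 3 * F) =
  F * (1 - F ^+ 2 + u * (E ^+ 2 - 3)) by rewrite -[in LHS]FE2; ring.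
exact: c2.
Qed.

(** With [u] replaced by its opposite, [dpotential] becomes [- D], so the cube of [D] must now be
    bounded from below. *)
Lemma curvature_bound_left b u : 0 <= b -> u <= 0 ->
  curvature b * dpotential b u ^+ 3 <=
  2 * expR u * (2 * potential b u * dpotential b u + dpotential b u ^+ 2
                - 2 * potential b u * d2potential b u).
Proof.
move=> b0; rewrite -[u]opprK; move: (- u) => {}u; rewrite oppr_le0 => u0.
have S := sinh_lb u0; have T := sinh_ub u; have CS := cosh_sinh_lb u0.
have Q := left_quadratic_ge0 u0; have E1 := expR_ge1Dx u.
have e2 : expR (- (2 * u)) = expR (- u) ^+ 2 by rewrite -mulrN expRM_natl.
have EF := expRxMexpNx_1 u; have F0 := expR_gt0 (- u).
rewrite /potential /dpotential /d2potential !mulrN opprK.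
move: Q EF F0 CS S T E1; rewrite e2 (expRM_natl 2 u).
move: (expR u) (expR (- u)) => E F Q EF F0 CS S T E1.
have E0 : 0 < E by lra.
have FE2 : F * E ^+ 2 = E by rewrite expr2 mulrA [F * E]mulrC EF mul1r.
have F1 : F <= 1 by nra.
have u20 : 0 <= u ^+ 2 by rewrite exprn_ge0.
have dE : E ^+ 2 - 1 = E * (E - F) by rewrite mulrBr EF.
have E21 : 0 <= E ^+ 2 - 1 by rewrite dE mulr_ge0//; lra.
pose D := 2 * u + 2 * b * (E ^+ 2 - 1).
have D1 : 2 * u * (1 + 2 * b * E) <= D.
  by rewrite /D dE; have := ler_wpM2l b0 (ler_wpM2l (ltW E0) S); lra.
have D2 : 0 <= 2 * u * (1 + 2 * b * E).
  by rewrite mulr_ge0 ?addr_ge0 ?mulr_ge0//; lra.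
have B0 : 0 < (1 + 2 * b) ^+ 2 by rewrite exprn_gt0//; lra.
have k0 : 0 <= curvature b.
  by rewrite /curvature divr_ge0 ?mulr_ge0 ?(ltW B0)//; lra.
(* The factor linear in [b] is the first-order Taylor polynomial at 0 of
   [curvature b * (1 + 2 * b * E) ^+ 2], which stays above it because [1 <= E]. *)
have K : 4 * u ^+ 2 * (1 + (4 * E - 2 / 3) * b) * D <= curvature b * D ^+ 3.
  rewrite [D ^+ 3]exprSr [leRHS]mulrA ler_wpM2r ?(le_trans D2)//.
  apply: (@le_trans _ _ (curvature b * (2 * u * (1 + 2 * b * E)) ^+ 2)); last first.
    by rewrite ler_wpM2l// lerXn2r ?nnegrE// (le_trans D2).
  have -> : 4 * u ^+ 2 * (1 + (4 * E - 2 / 3) * b) =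
    (1 + (4 * E - 2 / 3) * b) * (2 * u) ^+ 2 by ring.
  have -> : curvature b * (2 * u * (1 + 2 * b * E)) ^+ 2 =
    curvature b * (1 + 2 * b * E) ^+ 2 * (2 * u) ^+ 2 by ring.
  rewrite ler_wpM2r ?sqr_ge0// /curvature.
  rewrite mulrAC ler_pdivlMr; last by rewrite mulr_gt0.
  rewrite -subr_ge0 [X in 0 <= X](_ : _ =
    16 * b ^+ 2 * (E - 1) * (1 + 2 * b)
    + (3 + 10 * b) * (4 * b ^+ 2 * (E - 1) ^+ 2)); last by field.
  by rewrite addr_ge0 ?mulr_ge0 ?sqr_ge0//; lra.
have c0 : 0 <= 4 * u ^+ 3 * (1 - F) by rewrite !mulr_ge0 ?exprn_ge0//; lra.
have c1 : 0 <= - 12 * u ^+ 2 * (E - F) + 4 * u * (E + F) - 4 * (E - F)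
    + 4 * u ^+ 2 * (E ^+ 2 - 1 + (4 * E - 2 / 3) * u).
  (* [CS] contributes [8 / 3 * u ^+ 3], which cancels the term with [- 2 / 3]; there remains [4 * u
     ^+ 2 * (4 * u * E - (3 - E) * (E - F))]. *)
  rewrite dE.
  have s1 : (3 - E) * (E - F) <= 2 * (E - F) by rewrite ler_wpM2r; lra.
  have s2 : (3 - E) * (E - F) <= 4 * u * E by lra.
  by have := ler_wpM2l u20 s2; lra.
have c2 : 0 <= 8 * (E - E * E ^+ 2 - u * F + 3 * u * E)
    + 4 * u ^+ 2 * (4 * E - 2 / 3) * (E ^+ 2 - 1).
  have s1 := mulr_ge0 (ltW E0) Q.
  have EF2 : E * F ^+ 2 = F by rewrite expr2 mulrA EF mul1r.
  (* [Q] accounts for [10 / 3 * E] in the coefficient [4 * E - 2 / 3]; the excess is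
     [2 / 3 * (E - 1)]. *)
  have s2 : 0 <= u ^+ 2 * (E ^+ 2 - 1) * (E - 1) by rewrite !mulr_ge0//; lra.
  have s3 : u * (E * F ^+ 2) = u * F by rewrite EF2.
  by lra.
rewrite -subr_ge0.
apply: (@le_trans _ _ (2 * (4 * u ^+ 3 * (1 - F)
  + b * (- 12 * u ^+ 2 * (E - F) + 4 * u * (E + F) - 4 * (E - F)
    + 4 * u ^+ 2 * (E ^+ 2 - 1 + (4 * E - 2 / 3) * u))
  + b ^+ 2 * (8 * (E - E * E ^+ 2 - u * F + 3 * u * E)
    + 4 * u ^+ 2 * (4 * E - 2 / 3) * (E ^+ 2 - 1))))).
  rewrite mulr_ge0// addr_ge0//; last by rewrite mulr_ge0 ?sqr_ge0.
  by rewrite addr_ge0// mulr_ge0.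
have -> : curvature b * (- (2 * u) + 2 * b * (1 - E ^+ 2)) ^+ 3 =
    - (curvature b * D ^+ 3) by rewrite /D; ring.
rewrite opprK; apply: le_trans (lerD (lexx _) K).
rewrite [X in _ <= X + _](_ : _ = 2 * (- (4 * u ^+ 3 * F)
  + b * (12 * u ^+ 2 * (F - F * E ^+ 2) + 4 * u * (F + F * E ^+ 2)
         + 4 * (F - F * E ^+ 2))
  + b ^+ 2 * (8 * (F * E ^+ 2 - F * E ^+ 2 * E ^+ 2
                   - u * (F - 3 * (F * E ^+ 2)))))); last by ring.
by rewrite FE2 /D le_eqVlt; apply/orP; left; apply/eqP; ring.
Qed.

End scaled_potential.

(** * Convexity of the width in the amplitude *)

Section width_convexity.
Context {R : realType}.
Variable b : R.
Hypothesis b_ge0 : 0 <= b.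
Implicit Types u v : R.

Local Notation W := (potential b).
Local Notation W' := (dpotential b).
Local Notation W'' := (d2potential b).

Lemma is_derive_potential u : is_derive u 1 W (W' u).
Proof.
have -> : W = fun u => u * u + b * (expR (- (2 * u)) - 1 + 2 * u).
  by apply/funext => x; rewrite /potential expr2.
apply: is_derive_eq; first derive_rules.
by rewrite /dpotential /GRing.scale/=; ring.
Qed.

Lemma is_derive_dpotential u : is_derive u 1 W' (W'' u).
Proof.
have -> : W' = fun u => 2 * u + 2 * b * (1 - expR (- (2 * u))) by [].
apply: is_derive_eq; first derive_rules.
by rewrite /d2potential /GRing.scale/=; ring.
Qed.

Lemma potential0 : W 0 = 0.
Proof. by rewrite /potential !mulr0 oppr0 expR0; ring. Qed.

Lemma potential_gt0 u : u != 0 -> 0 < W u.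
Proof.
move=> u0; rewrite /potential ltr_pwDl ?exprn_even_gt0// mulr_ge0//.
by have := expR_ge1Dx (- (2 * u)); lra.
Qed.

Lemma dpotential_gt0 u : 0 < u -> 0 < W' u.
Proof.
move=> u0; rewrite /dpotential ltr_pwDl ?mulr_gt0// !mulr_ge0// subr_ge0.
by rewrite expR_le1; lra.
Qed.

Lemma dpotential_lt0 u : u < 0 -> W' u < 0.
Proof.
move=> u0; have h : 0 <= expR (- (2 * u)) - 1.
  by have := expR_ge1Dx (- (2 * u)); lra.
by rewrite /dpotential; have := mulr_ge0 b_ge0 h; lra.
Qed.

Lemma potential_continuous : continuous W.
Proof. by move=> u; exact: (is_derive_continuous (is_derive_potential u)). Qed.

Lemma potential_incr u v : 0 <= u -> u < v -> W u < W v.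
Proof.
move=> u0 uv; have [|c] := MVT uv (fun x _ => is_derive_potential x).
  by apply: continuous_subspaceT; exact: potential_continuous.
rewrite in_itv/= => /andP[uc _] e; rewrite -subr_gt0 e.
by rewrite mulr_gt0 ?subr_gt0// dpotential_gt0// (le_lt_trans u0).
Qed.

Lemma potential_decr u v : v <= 0 -> u < v -> W v < W u.
Proof.
move=> v0 uv; have [|c] := MVT uv (fun x _ => is_derive_potential x).
  by apply: continuous_subspaceT; exact: potential_continuous.
rewrite in_itv/= => /andP[_ cv] e; rewrite -subr_lt0 e.
by rewrite nmulr_rlt0 ?subr_gt0// dpotential_lt0// (lt_le_trans cv).
Qed.

(* Half the derivative of [expR u - curvature b / 2 * W u] with respect to
   [Num.sqrt (W u)]. *)
Let slope u := Num.sqrt (W u) * (expR u / W' u - curvature b / 2).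

Let dslope u :=
  (2 * expR u * (2 * W u * W' u + W' u ^+ 2 - 2 * W u * W'' u)
   - curvature b * W' u ^+ 3) / (4 * Num.sqrt (W u) * W' u ^+ 2).

Let dslope_ge0 u : 0 <= dslope u.
Proof.
apply: divr_ge0; last first.
  by apply: mulr_ge0; [apply: mulr_ge0; rewrite ?sqrtr_ge0|exact: sqr_ge0].
rewrite subr_ge0.
have [u0|u0] := leP 0 u; first exact: curvature_bound_right.
exact/curvature_bound_left/ltW.
Qed.

Let dpotential_neq0 u : u != 0 -> W' u != 0.
Proof.
by rewrite neq_lt => /orP[/dpotential_lt0/lt_eqF|/dpotential_gt0/gt_eqF] ->.
Qed.

Let is_derive_sqrt_potential u : u != 0 ->
  is_derive u 1 (fun x => Num.sqrt (W x)) (W' u / (2 * Num.sqrt (W u))).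
Proof.
move=> u0; rewrite mulrC.
apply: (is_derive1_comp (f := Num.sqrt) (g := W)).
  exact/is_derive1_sqrt/potential_gt0.
exact: is_derive_potential.
Qed.

Let is_derive_slope u : u != 0 -> is_derive u 1 slope (dslope u).
Proof.
move=> u0; have d0 := dpotential_neq0 u0; have W0 := potential_gt0 u0.
have s0 : 0 < Num.sqrt (W u) by rewrite sqrtr_gt0.
have dV : is_derive u 1 (fun x => (W' x)^-1) (- W' u ^- 2 * W'' u).
  by apply: is_deriveV => //; exact: is_derive_dpotential.
have dE : is_derive u 1 (fun x => expR x * (W' x)^-1)
    (expR u * (W' u)^-1 + expR u * (- W' u ^- 2 * W'' u)).
  by apply: is_derive_mul => //; exact: is_derive_expR.
have dB : is_derive u 1 (fun x => expR x * (W' x)^-1 - curvature b / 2)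
    (expR u * (W' u)^-1 + expR u * (- W' u ^- 2 * W'' u) + - 0).
  by apply: is_derive_add => //; apply: is_derive_opp; exact: is_derive_const.
apply: is_derive_eq.
  exact: (is_derive_mul (is_derive_sqrt_potential u0) dB).
rewrite /dslope -{3 4}(sqr_sqrtr (ltW W0)).
by field; rewrite d0 gt_eqF.
Qed.

(** The condition [0 < u * v] keeps the interval away from 0, where [W'] vanishes. *)
Let slope_nondecr u v : u <= v -> 0 < u * v -> slope u <= slope v.
Proof.
rewrite le_eqVlt => /predU1P[->//|uv uv0].
have nz x : u <= x <= v -> x != 0.
  move=> /andP[ux xv]; apply/eqP => x0; subst x.
  have : u * v <= 0 by rewrite mulr_le0_ge0.
  by rewrite leNgt uv0.
have [x|x|c] := @MVT _ slope dslope u v uv.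
- by rewrite in_itv/= => /andP[ux xv]; apply/is_derive_slope/nz; rewrite !ltW.
- apply: derivable_within_continuous => {}x; rewrite in_itv/= => uxv.
  by apply: (@ex_derive _ _ _ _ _ _ _ (is_derive_slope (nz _ uxv))).
move=> _ e; rewrite -subr_ge0 e.
by rewrite mulr_ge0 ?dslope_ge0 ?subr_ge0 ?ltW.
Qed.

Let height u := expR u - curvature b / 2 * W u.

(** Cauchy's mean value theorem for [height] against the square root of [W], whose derivatives have
    ratio [2 * slope]. An endpoint may be 0, since derivatives are taken only inside. *)
Let height_chord u v : u < v -> 0 <= u * v -> exists2 c,
  (u < c < v) /\ c != 0 &
  height v - height u = 2 * slope c * (Num.sqrt (W v) - Num.sqrt (W u)).
Proof.
move=> uv uv0.
have nz x : x \in `]u, v[ -> x != 0.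
  rewrite in_itv/= => /andP[ux xv]; apply/eqP => x0; subst x.
  by move: uv0; rewrite leNgt nmulr_rlt0 ?xv.
pose dheight x := expR x - curvature b / 2 * W' x.
have dh (x : R) : is_derive x 1 height (dheight x).
  have dW := is_derive_mul (is_derive_const (curvature b / 2) x)
    (is_derive_potential x).
  rewrite mul0r add0r in dW.
  exact: (is_derive_add (is_derive_expR x) (is_derive_opp dW)).
pose ds x := W' x / (2 * Num.sqrt (W x)).
have s0 x : x \in `]u, v[ -> 0 < Num.sqrt (W x).
  by move=> /nz x0; rewrite sqrtr_gt0 potential_gt0.
have ds0 x : x \in `]u, v[ -> ds x != 0.
  move=> xuv; apply: mulf_neq0; first exact/dpotential_neq0/nz.
  by rewrite invr_neq0// mulf_neq0// gt_eqF ?s0.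
have cs : {within `[u, v], continuous (fun x => Num.sqrt (W x))}.
  apply: continuous_subspaceT => x.
  apply: continuous_comp; first exact: potential_continuous.
  exact: sqrt_continuous.
have ch : {within `[u, v], continuous height}.
  by apply: continuous_subspaceT => x; exact: is_derive_continuous.
have dsq x : x \in `]u, v[ -> is_derive x 1 (fun x => Num.sqrt (W x)) (ds x).
  by move=> /nz; exact: is_derive_sqrt_potential.
have := differentiable_subr_neq0 uv cs dsq ds0.
have [c cuv] := cauchy_MVT uv ch cs (fun x _ => dh x) dsq ds0.
move=> e n0; exists c; first by split; [rewrite in_itv in cuv|exact: nz].
rewrite -[LHS](mulfVK n0) -e; congr (_ * _).
have sc := s0 _ cuv; have dc := dpotential_neq0 (nz _ cuv).
by rewrite /dheight /ds /slope; field; rewrite ?dc ?gt_eqF.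
Qed.

(* Subtracting [curvature b / 2 * W] changes both branches of [expR] by the same
   function of [h], so it drops out of the difference; it makes the right branch
   convex and the left one concave. *)
Lemma width_convex u1 u2 u3 v1 v2 v3 h1 h2 h3 :
  0 <= h1 -> h1 < h2 -> h2 < h3 ->
  0 <= u1 -> u1 < u2 -> u2 < u3 -> v1 <= 0 -> v2 < v1 -> v3 < v2 ->
  W u1 = h1 ^+ 2 -> W u2 = h2 ^+ 2 -> W u3 = h3 ^+ 2 ->
  W v1 = h1 ^+ 2 -> W v2 = h2 ^+ 2 -> W v3 = h3 ^+ 2 ->
  ((expR u2 - expR v2) - (expR u1 - expR v1)) * (h3 - h2) <=
  ((expR u3 - expR v3) - (expR u2 - expR v2)) * (h2 - h1).
Proof.
move=> h10 h12 h23 u10 u12 u23 v10 v21 v32 Wu1 Wu2 Wu3 Wv1 Wv2 Wv3.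
have u20 := le_lt_trans u10 u12; have v20 := lt_le_trans v21 v10.
have h20 := le_lt_trans h10 h12; have h30 := lt_trans h20 h23.
have sq h : 0 <= h -> Num.sqrt (h ^+ 2) = h.
  by move=> h0; rewrite sqrtr_sqr ger0_norm.
have [||c12 [/andP[c1u c1l] c10]] := @height_chord u1 u2; rewrite ?mulr_ge0 ?(ltW u20)//.
rewrite /height Wu1 Wu2 !sq ?(ltW h20)// => eu12.
have [||c23 [/andP[c2u c2l] c20]] := @height_chord u2 u3; rewrite ?mulr_ge0 ?(ltW u20)//.
  exact: ltW (lt_trans u20 u23).
rewrite /height Wu2 Wu3 !sq ?(ltW h20) ?(ltW h30)// => eu23.
have [||d12 [/andP[d1u d1l] d10]] := @height_chord v2 v1; rewrite ?mulr_le0 ?(ltW v20)//.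
rewrite /height Wv1 Wv2 !sq ?(ltW h20)// => ev12.
have [||d23 [/andP[d2u d2l] d20]] := @height_chord v3 v2; rewrite ?mulr_le0 ?(ltW v20)//.
  exact: ltW (lt_trans v32 v20).
rewrite /height Wv2 Wv3 !sq ?(ltW h20) ?(ltW h30)// => ev23.
have su : slope c12 <= slope c23.
  apply: slope_nondecr; first exact/ltW/(lt_trans c1l).
  exact: mulr_gt0 (le_lt_trans u10 c1u) (lt_trans u20 c2u).
(* On the left branch a larger [h] lies further left, so the order is reversed: this is the
   concavity. *)
have sv : slope d23 <= slope d12.
  apply: slope_nondecr; first exact/ltW/(lt_trans d2l).
  by rewrite -mulrNN mulr_gt0 ?oppr_gt0 ?(lt_le_trans d1l)// (lt_trans d2l).
have -> : expR u2 - expR v2 - (expR u1 - expR v1) =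
  2 * (slope c12 - slope d12) * (h2 - h1) by lra.
have -> : expR u3 - expR v3 - (expR u2 - expR v2) =
  2 * (slope c23 - slope d23) * (h3 - h2) by lra.
rewrite [leRHS]mulrAC ler_wpM2r ?ler_wpM2r ?subr_ge0 ?(ltW h12) ?(ltW h23)//.
lra.
Qed.

End width_convexity.

(** * The layer cake formula *)

Section layer_cake.
Context {R : realType}.
Local Notation mu := (@lebesgue_measure R).

(** Tonelli for the indicator of the plane region [0 < y < G r], with [G] extending [g] by 0:
    integrating first in [y] gives [g], first in [r] the measures of the superlevel sets. Their
    measurability is recorded for later comparisons of integrals. *)
Lemma layer_cake (D : set R) (g : R -> R) : measurable D ->
  measurable_fun D g -> (forall r, D r -> 0 <= g r) ->
  measurable_fun (`]0, +oo[%classic : set R)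
    ((fun y => mu (D `&` [set r | y < g r])) : R -> \bar R) /\
  (\int[mu]_(r in D) (g r)%:E =
   \int[mu]_(y in `]0%R, +oo[) mu (D `&` [set r | (y < g r)%R]))%E.
Proof.
move=> mD mg g0; pose G := g \_ D.
have mG : measurable_fun setT G by apply/(measurable_restrictT _ mD).
have G0 r : 0 <= G r.
  by rewrite /G patchE; case: ifPn => // /set_mem; exact: g0.
pose A : set (measurableTypeR R * measurableTypeR R) :=
  [set p | 0 < p.2 < G p.1].
have mA : measurable A.
  rewrite [X in measurable X](_ : _ =
    (fun p : measurableTypeR R * measurableTypeR R => 0 < p.2) @^-1` [set true] `&`
    (fun p : measurableTypeR R * measurableTypeR R => p.2 < G p.1) @^-1` [set true]);
    last by apply/seteqP; split => p /= /andP.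
  apply: measurableI; rewrite -[X in measurable X]setTI.
  - suff : measurable_fun [set: measurableTypeR R * measurableTypeR R]
        (fun p => 0 < p.2) by apply.
    by apply: measurable_fun_ltr => //; exact: measurable_snd.
  - suff : measurable_fun [set: measurableTypeR R * measurableTypeR R]
        (fun p => p.2 < G p.1) by apply.
    apply: measurable_fun_ltr; first exact: measurable_snd.
    by apply: (measurableT_comp mG); exact: measurable_fst.
pose f (p : measurableTypeR R * measurableTypeR R) : \bar R := (\1_A p)%:E.
have mf : measurable_fun setT f by apply/measurable_EFinP; exact: measurable_indic.
have f0 p : (0 <= f p)%E by rewrite lee_fin.
have inner y : 0 < y ->
    (\int[mu]_r f (r, y) = mu (D `&` [set r | (y < g r)%R]))%E.
  move=> y0.
  have mS : measurable (D `&` [set r | y < g r]).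
    have := measurable_fun_ltr (measurable_cst y) mg.
    by move=> /(_ mD [set true] I); congr measurable.
  rewrite -[D `&` _]setIT -integral_indic ?setIT//.
  apply: eq_integral => r _; rewrite /f !indicE; congr ((nat_of_bool _)%:R%:E).
  apply/idP/idP => /set_mem h; apply/mem_set.
  - move: h; rewrite /A/= y0/= /G patchE.
    by case: ifPn => [/set_mem//|_]; rewrite ltNge (ltW y0).
  - by case: h => Dr yr; rewrite /A/= y0/= /G patchE mem_set.
split.
  have := measurable_fun_fubini_tonelli_G (m1 := mu) f mf f0.
  move=> /(measurable_funS measurableT (@subsetT _ _)) => /(_ (`]0, +oo[%classic : set R)).
  apply: eq_measurable_fun => y; rewrite inE/= in_itv/= andbT => y0.
  exact: inner.
transitivity (\int[mu]_r \int[mu]_y f (r, y))%E.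
  rewrite integral_mkcond; apply: eq_integral => r _.
  have -> : ((fun r => (g r)%:E) \_ D) r = (G r)%:E.
    by rewrite /G !patchE; case: ifPn.
  rewrite (_ : (\int[mu]_y f (r, y) = \int[mu]_y (\1_`]0%R, G r[ y)%:E)%E); last first.
    by apply: eq_integral => y _; rewrite /f !indicE; congr ((nat_of_bool _)%:R%:E).
  rewrite integral_indic//= setIT lebesgue_measure_itv/= lte_fin.
  case: ltP => [_|]; first by rewrite oppr0 addr0.
  by move=> Gr; congr EFin; apply/eqP; rewrite eq_le Gr G0.
rewrite (fubini_tonelli f)// [RHS]integral_mkcond.
apply: eq_integral => y _; rewrite patchE; case: ifPn.
  by move=> /set_mem/=; rewrite in_itv/= andbT; exact: inner.
move=> /negP h; apply: integral0_eq => r _; rewrite /f indicE memNset// => /andP[y0 _].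
by apply: h; apply/mem_set; rewrite /= in_itv/= y0.
Qed.

End layer_cake.

(** * Width of the well and time spent in it *)

Section well_width.
Context {R : realType}.
Variables (b r0 : R) (inn out : R -> R).
Hypotheses (b_ge0 : 0 <= b) (r0_gt0 : 0 < r0).

Local Notation mu := (@lebesgue_measure R).
Implicit Types h r s t : R.

Local Notation V := (fun r : R => potential b (ln (r / r0))).

Hypothesis inn_bnd : forall h, 0 <= h -> 0 < inn h <= r0.
Hypothesis out_bnd : forall h, 0 <= h -> r0 <= out h.
Hypothesis V_inn : forall h, 0 <= h -> V (inn h) = h ^+ 2.
Hypothesis V_out : forall h, 0 <= h -> V (out h) = h ^+ 2.

Definition width h := out h - inn h.

Let ln_ratio_lt r s : 0 < r -> r < s -> ln (r / r0) < ln (s / r0).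
Proof.
move=> r_gt0 rs; rewrite ltr_ln ?posrE ?divr_gt0// ?(lt_trans r_gt0)//.
by rewrite ltr_pM2r ?invr_gt0.
Qed.

Let V_lt_inn r s : 0 < r -> r <= r0 -> 0 < s -> s <= r0 ->
  (V r < V s) = (s < r).
Proof.
have decr x y : 0 < x -> x < y -> y <= r0 -> V y < V x.
  move=> x0 xy yr0; apply: potential_decr => //; last exact: ln_ratio_lt.
  by rewrite ln_le0// ler_pdivrMr// mul1r.
move=> r_gt0 rr0 s_gt0 sr0; have [rs|sr|->] := ltgtP r s; last by rewrite ltxx.
- by apply/negbTE; rewrite -leNgt ltW// decr.
- exact: decr.
Qed.

Let V_lt_out r s : r0 <= r -> r0 <= s -> (V r < V s) = (r < s).
Proof.
have incr x y : r0 <= x -> x < y -> V x < V y.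
  move=> x0 xy; apply: potential_incr => //.
    by rewrite ln_ge0// ler_pdivlMr// mul1r.
  exact: ln_ratio_lt (lt_le_trans r0_gt0 x0) xy.
move=> rr0 sr0; have [rs|sr|->] := ltgtP r s; last by rewrite ltxx.
- exact: incr.
- by apply/negbTE; rewrite -leNgt ltW// incr.
Qed.

Let V_lt_sqr h r : 0 <= h -> 0 < r -> (V r < h ^+ 2) = (inn h < r < out h).
Proof.
move=> h0 r_gt0; have /andP[i0 ir] := inn_bnd h0; have o := out_bnd h0.
have [rr0|rr0] := leP r r0.
  rewrite -(V_inn h0) V_lt_inn//; case: (ltP (inn h)) => //= ir'.
  (* At [r = r0] the bound [r0 <= out h] is not strict; there [inn h < r0] gives [V r0 < h ^+ 2],
     hence [r0 < out h]. *)
  apply/esym; case: (eqVneq r r0) => [e|n]; last first.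
    by apply: lt_le_trans o; rewrite lt_neqAle n.
  rewrite e -V_lt_out// V_out// -(V_inn h0) V_lt_inn//.
  by rewrite -e.
rewrite -(V_out h0) V_lt_out ?(ltW rr0)//.
by rewrite (le_lt_trans ir rr0).
Qed.

Let sqr_lt_V h r : 0 <= h -> 0 < r ->
  (h ^+ 2 < V r) = ~~ (inn h <= r <= out h).
Proof.
move=> h0 r_gt0; have /andP[i0 ir] := inn_bnd h0; have o := out_bnd h0.
have [rr0|rr0] := leP r r0.
  rewrite -(V_inn h0) V_lt_inn// ltNge; congr (~~ _).
  by rewrite (le_trans rr0 o) andbT.
rewrite -(V_out h0) V_lt_out ?(ltW rr0)// ltNge.
by rewrite (ltW (le_lt_trans ir rr0)).
Qed.

Let lt_sqr h h' : 0 <= h -> h < h' -> h ^+ 2 < h' ^+ 2.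
Proof. by move=> h0 hh'; rewrite ltr_pXn2r// nnegrE// ltW// (le_lt_trans h0). Qed.

Let inn_lt h h' : 0 <= h -> h < h' -> inn h' < inn h.
Proof.
move=> h0 hh'; have h'0 := ltW (le_lt_trans h0 hh').
have /andP[i0 ir] := inn_bnd h0; have /andP[i'0 i'r] := inn_bnd h'0.
by rewrite -V_lt_inn// !V_inn// lt_sqr.
Qed.

Let out_lt h h' : 0 <= h -> h < h' -> out h < out h'.
Proof.
move=> h0 hh'; have h'0 := ltW (le_lt_trans h0 hh').
by rewrite -V_lt_out ?out_bnd// !V_out// lt_sqr.
Qed.

Let width0 : width 0 = 0.
Proof.
have /andP[i0 ir] := inn_bnd (lexx (0 : R)); have o := out_bnd (lexx (0 : R)).
have V0 : V r0 = 0 ^+ 2 by rewrite divff ?gt_eqF// ln1 potential0 expr0n.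
have e1 : inn 0 = r0.
  apply/eqP; rewrite eq_le ir/= leNgt -V_lt_inn//.
  by rewrite V0 V_inn ?ltxx.
have e2 : out 0 = r0.
  apply/eqP; rewrite eq_le o andbT leNgt -V_lt_out//.
  by rewrite V0 V_out ?ltxx.
by rewrite /width e1 e2 subrr.
Qed.

Lemma width_gt0 h : 0 < h -> 0 < width h.
Proof.
move=> h0; rewrite -width0 /width.
by have := inn_lt (lexx (0 : R)) h0; have := out_lt (lexx (0 : R)) h0; lra.
Qed.

(** Convexity as a division-free comparison of chord slopes: [width_convex] at the logarithms of the
    turning points, rescaled by [r0]. *)
Lemma width_three_point h1 h2 h3 : 0 <= h1 -> h1 < h2 -> h2 < h3 ->
  (width h2 - width h1) * (h3 - h2) <= (width h3 - width h2) * (h2 - h1).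
Proof.
move=> h10 h12 h23; have h20 := ltW (le_lt_trans h10 h12).
have h30 := ltW (le_lt_trans h20 h23).
have lnr r : 0 < r -> expR (ln (r / r0)) = r / r0.
  by move=> r_gt0; rewrite lnK// posrE divr_gt0.
have ipos h : 0 <= h -> 0 < inn h by move=> /inn_bnd/andP[].
have opos h : 0 <= h -> 0 < out h by move=> /out_bnd; exact: lt_le_trans.
have u0 : 0 <= ln (out h1 / r0).
  by rewrite ln_ge0// ler_pdivlMr// mul1r out_bnd.
have v0 : ln (inn h1 / r0) <= 0.
  by rewrite ln_le0// ler_pdivrMr// mul1r; have /andP[] := inn_bnd h10.
have := width_convex b_ge0 h10 h12 h23 u0
  (ln_ratio_lt (opos _ h10) (out_lt h10 h12))
  (ln_ratio_lt (opos _ h20) (out_lt h20 h23)) v0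
  (ln_ratio_lt (ipos _ h20) (inn_lt h10 h12))
  (ln_ratio_lt (ipos _ h30) (inn_lt h20 h23))
  (V_out h10) (V_out h20) (V_out h30) (V_inn h10) (V_inn h20) (V_inn h30).
rewrite !lnr ?ipos ?opos// -(ler_pM2r r0_gt0).
have unscale x y z w c : (x / r0 - y / r0 - (z / r0 - w / r0)) * c * r0 =
    (x - y - (z - w)) * c by field; rewrite gt_eqF.
by rewrite !unscale.
Qed.

(* By convexity, [width h] and [width (t * h')] lie below the chord of [width]
   between [t * h] and [h']; the weights [h'] and [h] balance. *)
Lemma width_increment_ratio h h' t : 0 < h -> h <= h' -> 0 <= t <= 1 ->
  h' * (width h - width (t * h)) <= h * (width h' - width (t * h')).
Proof.
move=> h0; rewrite le_eqVlt => /predU1P[<-//|hh'] /andP[t0].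
rewrite le_eqVlt => /predU1P[->|t1]; first by rewrite !mul1r !subrr !mulr0.
have th0 : 0 <= t * h by rewrite mulr_ge0// ltW.
have thh : t * h < h by rewrite gtr_pMl.
have thh' := lt_trans thh hh'.
have chord q : t * h <= q <= h' ->
    (h' - t * h) * width q <=
    (h' - q) * width (t * h) + (q - t * h) * width h'.
  move=> /andP[]; rewrite le_eqVlt => /predU1P[<- _|tq].
    by rewrite subrr mul0r addr0.
  rewrite le_eqVlt => /predU1P[->|qh']; first by rewrite subrr mul0r add0r.
  by have := width_three_point th0 tq qh'; lra.
have h'0 := lt_trans h0 hh'.
have c1 : (h' - t * h) * width h <=
    (h' - h) * width (t * h) + (h - t * h) * width h'.
  by apply: chord; rewrite (ltW thh) ltW.
have c2 : (h' - t * h) * width (t * h') <=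
    (h' - t * h') * width (t * h) + (t * h' - t * h) * width h'.
  by apply: chord; rewrite ler_wpM2l ?(ltW hh')//= ger_pMl ?ltW.
have d0 : 0 < h' - t * h by rewrite subr_gt0.
rewrite -(ler_pM2l d0).
by have := ler_wpM2l (ltW h'0) c1; have := ler_wpM2l (ltW h0) c2; lra.
Qed.

(** The chord slope over [[t * h, h]] is at most the one over [[h, 2 * h]]. The factor [1 - t] makes
    the bound integrable in [y] when [t = level y]. *)
Lemma width_increment_le h t : 0 < h -> 0 <= t <= 1 ->
  width h - width (t * h) <= (1 - t) * (width (2 * h) - width h).
Proof.
move=> h0 /andP[t0]; rewrite le_eqVlt => /predU1P[->|t1].
  by rewrite mul1r !subrr mul0r.
have th0 : 0 <= t * h by rewrite mulr_ge0// ltW.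
have thh : t * h < h by rewrite gtr_pMl.
have hh : h < 2 * h by lra.
by rewrite -(ler_pM2r h0); have := width_three_point th0 thh hh; lra.
Qed.

Lemma width_increment_ge0 h t : 0 < h -> 0 <= t <= 1 ->
  0 <= width h - width (t * h).
Proof.
move=> h0 /andP[t0]; rewrite le_eqVlt => /predU1P[->|t1].
  by rewrite mul1r subrr.
have th0 : 0 <= t * h by rewrite mulr_ge0// ltW.
have thh : t * h < h by rewrite gtr_pMl.
by rewrite /width; have := inn_lt th0 thh; have := out_lt th0 thh; lra.
Qed.

Definition well h : set R := `]inn h, out h[%classic.

(** In spite of the name this is a reciprocal velocity, normalised to be 1 at the bottom of the
    well. *)
Definition speed h r := h / Num.sqrt (h ^+ 2 - V r).

(* For [1 <= y], [y < speed h r] means that [V r] exceeds the square of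
   [level y * h]. *)
Definition level (y : R) := Num.sqrt (Num.max 0 (1 - y ^- 2)).

Let well_pos h r : 0 <= h -> well h r -> 0 < r.
Proof.
move=> /inn_bnd/andP[i0 _]; rewrite /well/= in_itv/= => /andP[+ _].
exact: lt_trans.
Qed.

Let well_lt h r : 0 <= h -> well h r -> 0 < h ^+ 2 - V r.
Proof.
by move=> h0 hr; rewrite subr_gt0 V_lt_sqr// (well_pos h0 hr).
Qed.

Let level_itv y : 0 < y -> 0 <= level y <= 1.
Proof.
move=> y0; rewrite sqrtr_ge0/= -[leRHS]sqrtr1 ler_wsqrtr//.
by rewrite ge_max ler01 gerBl invr_ge0 exprn_ge0// ltW.
Qed.

(** For [y < 1] the right-hand side is at least 1. Otherwise [1 - s <= 1 - s ^+ 2] with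
    [s = level y] bounds the left by [y ^- 2]. The majorant has a finite integral. *)
Let level_ge y : 0 < y -> 1 - level y <= 2 * (oneDsqr y)^-1.
Proof.
move=> y0; have /andP[l0 l1] := level_itv y0.
have [y1|y1] := ltP y 1.
  apply: (@le_trans _ _ 1); first by rewrite gerBl.
  rewrite ler_pdivlMr ?mul1r /oneDsqr; last by have := sqr_ge0 y; lra.
  by have := lt_sqr (ltW y0) y1; rewrite expr1n; lra.
have y2 : 1 <= y ^+ 2 by rewrite exprn_ege1.
have yV : y ^- 2 <= 1 by rewrite invf_le1// (lt_le_trans ltr01).
have e : level y ^+ 2 = 1 - y ^- 2.
  by rewrite sqr_sqrtr ?max_r ?subr_ge0.
apply: (@le_trans _ _ (y ^- 2)); first by nra.
rewrite ler_pdivlMr /oneDsqr; last by lra.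
by rewrite mulrDr mulr1 mulVf ?gt_eqF ?(lt_le_trans ltr01)//; lra.
Qed.

Let level_lt1 y : 0 < y -> level y < 1.
Proof.
move=> y0; rewrite -sqrtr1 ltr_sqrt// gt_max ltr01/=.
by rewrite gtrBl invr_gt0 exprn_gt0.
Qed.

Let speed_gt y h r : 0 < y -> 0 < h -> well h r ->
  (y < speed h r) = ((1 - y ^- 2) * h ^+ 2 < V r).
Proof.
move=> y0 h0 hr; have d0 := well_lt (ltW h0) hr.
have s0 : 0 < Num.sqrt (h ^+ 2 - V r) by rewrite sqrtr_gt0.
rewrite /speed ltr_pdivlMr// -[LHS](@ltr_pXn2r _ 2)//; last 2 first.
- by rewrite nnegrE mulr_ge0// ltW.
- by rewrite nnegrE ltW.
rewrite exprMn sqr_sqrtr ?(ltW d0)// -ltr_pdivlMl ?exprn_gt0//.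
by apply/idP/idP; lra.
Qed.

Let mu_well h : 0 <= h -> mu (well h) = (width h)%:E.
Proof.
move=> h0; rewrite /well lebesgue_measure_itv/= lte_fin.
have /andP[_ ir] := inn_bnd h0; have o := out_bnd h0.
case: ltP => [_|]; first by rewrite -EFinB.
by move=> oi; congr EFin; rewrite /width; lra.
Qed.

Let mu_level h y : 0 < h -> 0 < y ->
  mu (well h `&` [set r | y < speed h r]) = (width h - width (level y * h))%:E.
Proof.
(* For [y < 1] the set is the whole well, in accordance with [level y = 0] and [width 0 = 0]. *)
move=> h0 y0; have [y1|y1] := ltP y 1.
  have neg : 1 - y ^- 2 < 0.
    by rewrite subr_lt0 invf_gt1 ?exprn_gt0// expr_lt1// ltW.
  have -> : level y = 0 by rewrite /level max_l ?sqrtr0// ltW.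
  rewrite mul0r width0 subr0 -mu_well ?ltW//; congr (mu _).
  apply/seteqP; split => [r []//|r hr]; split => //=.
  rewrite speed_gt//; apply: (@lt_le_trans _ _ 0).
    by rewrite nmulr_rlt0// exprn_gt0.
  have [->|n] := eqVneq (ln (r / r0)) 0; first by rewrite potential0.
  exact/ltW/potential_gt0.
have yV : y ^- 2 <= 1 by rewrite invf_le1 ?exprn_ege1// exprn_gt0.
have lh0 : 0 <= level y * h by rewrite mulr_ge0 ?sqrtr_ge0 ?ltW.
have lhh : level y * h < h by rewrite gtr_pMl// level_lt1.
(* The removed interval is closed because [y < speed h r] is strict. *)
pose K : set R := `[inn (level y * h), out (level y * h)]%classic.
have -> : well h `&` [set r | y < speed h r] = well h `\` K.
  have e : (level y * h) ^+ 2 = (1 - y ^- 2) * h ^+ 2.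
    by rewrite exprMn sqr_sqrtr ?max_r ?subr_ge0.
  apply/seteqP; split => r [hr]; have r_gt0 := well_pos (ltW h0) hr;
    rewrite /K/= in_itv/=.
    rewrite speed_gt// -e sqr_lt_V// => hK; split => //; exact/negP.
  by move=> /negP hK; split => //; rewrite speed_gt// -e sqr_lt_V.
have KS : K `<=` well h.
  move=> r; rewrite /K /well/= !in_itv/= => /andP[ir ro].
  by rewrite (lt_le_trans (inn_lt lh0 lhh) ir) (le_lt_trans ro (out_lt lh0 lhh)).
have muK : mu K = (width (level y * h))%:E.
  rewrite /K lebesgue_measure_itv/= lte_fin.
  have /andP[_ ir] := inn_bnd lh0; have o := out_bnd lh0.
  case: ltP => [_|]; first by rewrite -EFinB.
  by move=> oi; congr EFin; rewrite /width; lra.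
have fin : (mu (well h) < +oo)%E by rewrite mu_well ?ltry// ltW.
rewrite measureD//; [|exact: measurable_itv|exact: measurable_itv].
rewrite setIidr//; change (mu (well h) - mu K = (width h - width (level y * h))%:E)%E.
by rewrite muK mu_well// ltW.
Qed.

Let measurable_speed h : 0 <= h -> measurable_fun (well h) (speed h).
Proof.
move=> h0; apply: open_continuous_measurable_fun; first exact: interval_open.
move=> r; rewrite inE => hr; have r_gt0 := well_pos h0 hr.
have d0 := well_lt h0 hr.
have c1 : {for r, continuous (fun x : R => x / r0)}.
  by apply: cvgM; [exact: cvg_id|exact: cvg_cst].
have c2 : {for r, continuous (fun x : R => ln (x / r0))}.
  by apply: (continuous_comp c1); apply: continuous_ln; rewrite divr_gt0.
have c3 : {for r, continuous V}.
  by apply: (continuous_comp c2); exact: potential_continuous.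
have c4 : {for r, continuous (fun x : R => h ^+ 2 - V x)}.
  by apply: cvgB; [exact: cvg_cst|exact: c3].
have c5 : {for r, continuous (fun x : R => Num.sqrt (h ^+ 2 - V x))}.
  by apply: (continuous_comp c4); exact: sqrt_continuous.
apply: cvgM; first exact: cvg_cst.
by apply: cvgV; [rewrite gt_eqF// sqrtr_gt0|exact: c5].
Qed.

Let speed_ge1 h r : 0 < h -> well h r -> 1 <= speed h r.
Proof.
move=> h0 hr; have d0 := well_lt (ltW h0) hr.
have e : Num.sqrt (h ^+ 2) = h by rewrite sqrtr_sqr ger0_norm// ltW.
rewrite /speed ler_pdivlMr ?sqrtr_gt0// mul1r -[leRHS]e ler_wsqrtr// gerBl.
have [->|n] := eqVneq (ln (r / r0)) 0; first by rewrite potential0.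
exact/ltW/potential_gt0.
Qed.

Definition well_time h : \bar R := (\int[mu]_(r in well h) (speed h r)%:E)%E.

Lemma well_time_scale c h : 0 <= c -> 0 < h ->
  (c%:E * well_time h = \int[mu]_(r in well h) (c * speed h r)%:E)%E.
Proof.
move=> c0 h0; under [RHS]eq_integral do rewrite EFinM.
rewrite ge0_integralZl_EFin//; first exact: measurable_itv.
- by move=> r hr; rewrite lee_fin (le_trans ler01)// speed_ge1.
- by apply/measurable_EFinP; exact: measurable_speed (ltW h0).
Qed.

Let well_timeE h : 0 < h ->
  (well_time h = \int[mu]_(y in `]0%R, +oo[)
                   (width h - width (level y * h))%:E)%E /\
  measurable_fun (`]0, +oo[%classic : set R)
    (fun y => width h - width (level y * h)).
Proof.
move=> h0; have [|r hr|m e] := @layer_cake _ (well h) (speed h) _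
    (measurable_speed (ltW h0)).
- exact: measurable_itv.
- by rewrite (le_trans ler01)// speed_ge1.
split.
  rewrite /well_time e; apply: eq_integral => y; rewrite inE/= in_itv/= andbT.
  exact: mu_level.
apply/measurable_EFinP; apply: eq_measurable_fun m => y.
by rewrite inE/= in_itv/= andbT => y0; rewrite mu_level.
Qed.

(** The integrand is at least 1. This gives the positivity behind strict monotonicity, and the
    growth behind divergence. *)
Lemma well_time_ge h : 0 < h -> ((width h)%:E <= well_time h)%E.
Proof.
move=> h0; rewrite -(mu_well (ltW h0)) -[leLHS]mul1e.
rewrite -integral_cst; last exact: measurable_itv.
apply: ge0_le_integral => //.
- exact: measurable_itv.
- by apply/measurable_EFinP; exact: measurable_speed (ltW h0).
- by move=> r hr; rewrite lee_fin speed_ge1.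
Qed.

Lemma well_time_lty h : 0 < h -> (well_time h < +oo)%E.
Proof.
move=> h0; have [-> m] := well_timeE h0.
(* The factor 2 comes from [level_ge], the rest from [width_increment_le]. *)
pose C := 2 * (width (2 * h) - width h).
have C0 : 0 <= C.
  rewrite mulr_ge0//.
  have := @width_increment_ge0 (2 * h) (2^-1); rewrite mulrA mulVf// mul1r.
  by apply; [lra|apply/andP; split; lra].
apply: (@le_lt_trans _ _ (\int[mu]_(y in `]0%R, +oo[) (C * (oneDsqr y)^-1)%:E)%E).
  apply: ge0_le_integral => //.
  - by move=> y; rewrite /= in_itv/= andbT => y0; rewrite lee_fin
      width_increment_ge0// level_itv.
  - exact/measurable_EFinP.
  - apply/measurable_EFinP; apply: measurable_funM => //.
    apply: measurable_funS (measurableT) (@subsetT _ _) _.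
    by apply: continuous_measurable_fun; exact: continuous_oneDsqrV.
  - move=> y; rewrite /= in_itv/= andbT => y0; rewrite lee_fin.
    apply: le_trans (width_increment_le h0 (level_itv y0)) _.
    have h2 : 0 <= width (2 * h) - width h by rewrite /C in C0; lra.
    by have := ler_wpM2r h2 (level_ge y0); rewrite /C; lra.
(* The endpoint 0 is added to match the domain of [integral0y_oneDsqr]. *)
apply: (@le_lt_trans _ _ (\int[mu]_(y in `[0%R, +oo[) (C * (oneDsqr y)^-1)%:E)%E).
  apply: ge0_subset_integral => //.
  - apply/measurable_EFinP; apply: measurable_funM => //.
    apply: measurable_funS (measurableT) (@subsetT _ _) _.
    by apply: continuous_measurable_fun; exact: continuous_oneDsqrV.
  - by move=> y _; rewrite lee_fin mulr_ge0// invr_ge0 (le_trans ler01 (oneDsqr_ge1 y)).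
  - by move=> y; rewrite /= !in_itv/= !andbT => /ltW.
under eq_integral do rewrite EFinM.
rewrite ge0_integralZl_EFin//.
- by rewrite integral0y_oneDsqr -EFinM ltry.
- apply/measurable_EFinP; apply: measurable_funS (measurableT) (@subsetT _ _) _.
  by apply: continuous_measurable_fun; exact: continuous_oneDsqrV.
Qed.

(** [width_increment_ratio] with [t = level y], integrated over [y]; cross-multiplication avoids
    dividing extended reals. *)
Lemma well_time_ratio h h' : 0 < h -> h <= h' ->
  (h'%:E * well_time h <= h%:E * well_time h')%E.
Proof.
move=> h0 hh'; have h'0 := lt_le_trans h0 hh'.
have [-> m] := well_timeE h0; have [-> m'] := well_timeE h'0.
have nonneg x y : 0 < x -> (`]0, +oo[%classic : set R) y ->
    (0 <= (width x - width (level y * x))%:E)%E.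
  move=> x0; rewrite /= in_itv/= andbT => y0.
  by rewrite lee_fin width_increment_ge0// level_itv.
have scale c x : 0 < c -> 0 < x ->
    measurable_fun (`]0, +oo[%classic : set R)
      (fun y => width x - width (level y * x)) ->
    (c%:E * \int[mu]_(y in `]0%R, +oo[) (width x - width (level y * x))%:E =
     \int[mu]_(y in `]0%R, +oo[) (c * (width x - width (level y * x)))%:E)%E.
  move=> c0 x0 mx; under [RHS]eq_integral do rewrite EFinM.
  rewrite ge0_integralZl_EFin//; last 2 first.
  - exact/measurable_EFinP.
  - exact: ltW.
  by move=> y; exact: nonneg.
rewrite !scale//; apply: ge0_le_integral => //.
- by move=> y yD; rewrite EFinM mule_ge0 ?nonneg// lee_fin ltW.
- by apply/measurable_EFinP; apply: measurable_funM.
- by apply/measurable_EFinP; apply: measurable_funM.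
- move=> y; rewrite /= in_itv/= andbT => y0; rewrite lee_fin.
  by rewrite width_increment_ratio// level_itv.
Qed.

End well_width.

(** * The period in terms of the scaled well *)

Section wire.
Context {R : realType}.
Variables mu0 I0 L pz : R.
Hypotheses (mu0_gt0 : 0 < mu0) (I0_gt0 : 0 < I0) (L_gt0 : 0 < L).
Implicit Types h r H : R.

Local Notation k := (mu0 / (2 * pi) * I0).
Local Notation rbar := (rbar mu0 I0 L pz).
Local Notation H0 := (H0 mu0 I0 L pz).
Local Notation energy2 := (energy2 mu0 I0 L pz).
Local Notation turn_in := (turn_in mu0 I0 L pz).
Local Notation turn_out := (turn_out mu0 I0 L pz).
Local Notation period := (period mu0 I0 L pz).

(** The centrifugal term of [energy2] at [rbar], in units of [k ^+ 2]. *)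
Let b := L ^+ 2 / (k ^+ 2 * rbar ^+ 2).

Let k_gt0 : 0 < k.
Proof. by rewrite mulr_gt0// divr_gt0// mulr_gt0// pi_gt0. Qed.

Let rbar_gt0 : 0 < rbar.
Proof. by have [] := rbarP pz mu0_gt0 I0_gt0 L_gt0. Qed.

Let b_ge0 : 0 <= b.
Proof. by rewrite divr_ge0 ?sqr_ge0// mulr_ge0 ?sqr_ge0. Qed.

(** The equilibrium equation [rbarE] says [pz + k * ln rbar = k * b], so the cross term of the
    square yields the linear part [2 * b * u] of the potential. *)
Lemma energy2_potential r : 0 < r ->
  energy2 r = H0 ^+ 2 + k ^+ 2 * potential b (ln (r / rbar)).
Proof.
move=> r_gt0; rewrite H0_sqr.
have e1 : pz + k * ln rbar = L ^+ 2 / (k * rbar ^+ 2).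
  rewrite (rbarE pz mu0_gt0 I0_gt0 L_gt0).
  have p0 : pi != 0 :> R by rewrite gt_eqF// pi_gt0.
  by move: (pi) p0 => p p0; field; rewrite p0 !gt_eqF.
have e2 : expR (- (2 * ln (r / rbar))) = rbar ^+ 2 * r ^- 2.
  rewrite expRN expRM_natl lnK ?posrE ?divr_gt0//.
  by field; rewrite !gt_eqF.
have e3 : ln r = ln rbar + ln (r / rbar).
  by rewrite -lnM ?posrE ?divr_gt0// mulrC divfK// gt_eqF.
rewrite /potential e2 /Defs.energy2 e3 mulrDr addrA e1 /b.
move: (ln (r / rbar)) => u; move: k_gt0; set q := k => q_gt0.
by field; rewrite !gt_eqF.
Qed.

Let energy_of h := Num.sqrt (H0 ^+ 2 + k ^+ 2 * h ^+ 2).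

(** At [h = 0] the energy is [H0], for which [turn_in] and [turn_out] describe no point; both
    branches then take the value [rbar]. *)
Let inn h := if h == 0 then rbar else turn_in (energy_of h).
Let out h := if h == 0 then rbar else turn_out (energy_of h).

Let energy_of_sqr h : energy_of h ^+ 2 = H0 ^+ 2 + k ^+ 2 * h ^+ 2.
Proof. by rewrite sqr_sqrtr// addr_ge0 ?sqr_ge0// mulr_ge0 ?sqr_ge0. Qed.

Let energy_of_gt h : h != 0 -> H0 < energy_of h.
Proof.
move=> h0; have HH := H0_gt0 mu0 I0 L pz.
rewrite -[ltLHS]ger0_norm ?ltW// -sqrtr_sqr ltr_sqrt.
  rewrite ltrDl; apply: mulr_gt0; first exact: exprn_gt0.
  by rewrite exprn_even_gt0.
by rewrite ltr_pwDl ?exprn_gt0// mulr_ge0 ?sqr_ge0.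
Qed.

Let V_of_energy2 h r : 0 < r -> energy2 r = energy_of h ^+ 2 ->
  potential b (ln (r / rbar)) = h ^+ 2.
Proof.
move=> r_gt0; rewrite energy2_potential// energy_of_sqr => /addrI/mulfI; apply.
by rewrite expf_neq0// gt_eqF.
Qed.

Let inn_bnd h : 0 <= h -> 0 < inn h <= rbar.
Proof.
move=> _; rewrite /inn; case: eqVneq => [_|/energy_of_gt hH]; first by rewrite lexx rbar_gt0.
have [/andP[i0 ir] _] := turn_inP mu0_gt0 I0_gt0 L_gt0 hH.
by rewrite i0 ltW.
Qed.

Let out_bnd h : 0 <= h -> rbar <= out h.
Proof.
move=> _; rewrite /out; case: eqVneq => [//|/energy_of_gt hH].
by have [/ltW + _] := turn_outP mu0_gt0 I0_gt0 L_gt0 hH.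
Qed.

Let V_inn h : 0 <= h -> potential b (ln (inn h / rbar)) = h ^+ 2.
Proof.
move=> _; rewrite /inn; case: eqVneq => [->|/energy_of_gt hH].
  by rewrite divff ?gt_eqF// ln1 potential0 expr0n.
have [/andP[i0 _] +] := turn_inP mu0_gt0 I0_gt0 L_gt0 hH.
exact: V_of_energy2.
Qed.

Let V_out h : 0 <= h -> potential b (ln (out h / rbar)) = h ^+ 2.
Proof.
move=> _; rewrite /out; case: eqVneq => [->|/energy_of_gt hH].
  by rewrite divff ?gt_eqF// ln1 potential0 expr0n.
have [ro +] := turn_outP mu0_gt0 I0_gt0 L_gt0 hH.
exact/V_of_energy2/(lt_trans rbar_gt0).
Qed.

(* The [h] for which the turning points of energy [H] are those of the level
   [h ^+ 2] of [potential b (ln (r / rbar))]. *)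
Let amplitude H := Num.sqrt (H ^+ 2 - H0 ^+ 2) / k.

Let H_gt0 H : H0 < H -> 0 < H.
Proof. exact/lt_trans/H0_gt0. Qed.

Let sqr_H_gt H : H0 < H -> H0 ^+ 2 < H ^+ 2.
Proof.
have H00 := H0_gt0 mu0 I0 L pz.
by move=> hH; rewrite ltr_pXn2r// nnegrE ltW// (lt_trans H00).
Qed.

Let amplitude_gt0 H : H0 < H -> 0 < amplitude H.
Proof. by move=> hH; rewrite divr_gt0// sqrtr_gt0 subr_gt0 sqr_H_gt. Qed.

Let amplitude_sqr H : H0 < H -> k ^+ 2 * amplitude H ^+ 2 = H ^+ 2 - H0 ^+ 2.
Proof.
move=> hH; rewrite -exprMn /amplitude mulrC divfK ?gt_eqF// sqr_sqrtr//.
by rewrite subr_ge0 ltW// sqr_H_gt.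
Qed.

Let amplitudeK H : H0 < H -> energy_of (amplitude H) = H.
Proof.
move=> hH; rewrite /energy_of amplitude_sqr// addrC subrK sqrtr_sqr ger0_norm//.
exact/ltW/H_gt0.
Qed.

Local Notation time := (well_time b rbar inn out).

(** With [h = amplitude H], [H ^+ 2 - energy2 r] is [k ^+ 2] times [h ^+ 2 - V r], so the integrand
    is [H / (k * h)] times [speed h r]. *)
Lemma periodE H : H0 < H ->
  period H = ((2 * H / (k * amplitude H))%:E * time (amplitude H))%E.
Proof.
move=> hH; have h0 := amplitude_gt0 hH; have Hp := H_gt0 hH.
have kh0 : 0 < k * amplitude H by rewrite mulr_gt0.
rewrite -mulrA EFinM -muleA; congr (_ * _)%E.
rewrite (well_time_scale b_ge0 rbar_gt0 inn_bnd out_bnd V_inn V_out)//; last first.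
  by rewrite divr_ge0 ?ltW.
rewrite /well {1}/inn {1}/out gt_eqF// amplitudeK//.
apply: eq_integral => r; rewrite inE/= in_itv/= => /andP[ir ro]; congr EFin.
have [/andP[i0 _] _] := turn_inP mu0_gt0 I0_gt0 L_gt0 hH.
rewrite energy2_potential ?(lt_trans i0)// opprD addrA -amplitude_sqr// -mulrBr.
rewrite sqrtrM ?sqr_ge0// sqrtr_sqr (ger0_norm (ltW k_gt0)) /speed.
rewrite [in LHS]invfM; move: (Num.sqrt _)^-1 => s.
by move: k_gt0 h0; set q := k; move: (amplitude H) => h q0 h0; field; rewrite !gt_eqF.
Qed.

Lemma period_lt H H' : H0 < H -> H < H' -> (period H < period H')%E.
Proof.
move=> hH HH'; have hH' := lt_trans hH HH'.
have h0 := amplitude_gt0 hH; have h'0 := amplitude_gt0 hH'; have Hp := H_gt0 hH.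
have hh' : amplitude H <= amplitude H'.
  rewrite ler_pM2r ?invr_gt0// ler_wsqrtr// lerD2r.
  by rewrite lerXn2r ?nnegrE ?ltW// (lt_trans Hp).
rewrite !periodE//.
have lb := well_time_ge b_ge0 rbar_gt0 inn_bnd out_bnd V_inn V_out h0.
have w0 := width_gt0 b_ge0 rbar_gt0 inn_bnd out_bnd V_inn V_out h0.
have ub := well_time_lty b_ge0 rbar_gt0 inn_bnd out_bnd V_inn V_out h0.
have ub' := well_time_lty b_ge0 rbar_gt0 inn_bnd out_bnd V_inn V_out h'0.
have lb' := well_time_ge b_ge0 rbar_gt0 inn_bnd out_bnd V_inn V_out h'0.
have := well_time_ratio b_ge0 rbar_gt0 inn_bnd out_bnd V_inn V_out h0 hh'.
(* Both times are real numbers; at [+oo] strictness would be lost. *)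
move: lb ub lb' ub'; case: (time (amplitude H)) => [t| |] //; rewrite ?leeNy_eq//.
case: (time (amplitude H')) => [t'| |] //; rewrite ?leeNy_eq// !lee_fin => wt _ _ _.
rewrite -!EFinM lte_fin => rat.
have t0 : 0 < t by exact: lt_le_trans wt.
move: (amplitude H) (amplitude H') h0 h'0 rat => h h' h0 h'0 rat.
have step : t / h <= t' / h' by rewrite ler_pdivrMr// mulrAC ler_pdivlMr// mulrC [leRHS]mulrC.
have -> : 2 * H / (k * h) * t = 2 / k * (H * (t / h)).
  by move: k_gt0; set q := k => q0; field; rewrite !gt_eqF.
have -> : 2 * H' / (k * h') * t' = 2 / k * (H' * (t' / h')).
  by move: k_gt0; set q := k => q0; field; rewrite !gt_eqF.
rewrite ltr_pM2l ?divr_gt0//.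
(* Strictness comes from the factor [H] alone, as [t / h] is positive. *)
apply: (@lt_le_trans _ _ (H' * (t / h))); first by rewrite ltr_pM2r// divr_gt0.
by rewrite ler_pM2l// (lt_trans Hp).
Qed.

(** The time is at least the width of the well, which contains [[rbar, A]] up to endpoints, and the
    prefactor is at least 1 because [k * amplitude H <= H]. *)
Lemma period_ge H A : H0 < H -> rbar <= A -> energy2 A <= H ^+ 2 ->
  ((A - rbar)%:E <= period H)%E.
Proof.
move=> hH rA EA; have h0 := amplitude_gt0 hH; have Hp := H_gt0 hH.
have A0 := lt_le_trans rbar_gt0 rA.
have lb := well_time_ge b_ge0 rbar_gt0 inn_bnd out_bnd V_inn V_out h0.
have w0 := width_gt0 b_ge0 rbar_gt0 inn_bnd out_bnd V_inn V_out h0.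
have wA : A - rbar <= width inn out (amplitude H).
  have ir := inn_bnd (ltW h0); have o := out_bnd (ltW h0).
  apply: lerB; last by case/andP: ir.
  rewrite leNgt; apply/negP => oA.
  move: EA; rewrite energy2_potential// -lerBrDl -amplitude_sqr// ler_pM2l ?exprn_gt0//.
  rewrite -V_out ?(ltW h0)// leNgt => /negP; apply.
  have o0 := lt_le_trans rbar_gt0 o.
  apply: (potential_incr b_ge0); first by rewrite ln_ge0// ler_pdivlMr// mul1r.
  by rewrite ltr_ln ?posrE ?divr_gt0// ltr_pM2r ?invr_gt0.
rewrite periodE//; apply: (@le_trans _ _ (time (amplitude H))).
  by apply: le_trans lb; rewrite lee_fin.
have t0 : (0 <= time (amplitude H))%E by apply: le_trans lb; rewrite lee_fin ltW.
have kh0 : 0 < k * amplitude H by rewrite mulr_gt0.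
rewrite -[leLHS]mul1e; apply: lee_wpmul2r => //.
rewrite lee_fin ler_pdivlMr// mul1r.
apply: (@le_trans _ _ H); last by lra.
rewrite -[leRHS](ger0_norm (ltW Hp)) -sqrtr_sqr /amplitude mulrC divfK ?gt_eqF//.
by rewrite ler_wsqrtr// gerBl sqr_ge0.
Qed.

Lemma period_cvgy : period H @[H --> +oo] --> +oo%E.
Proof.
(* The maximum with 0 ensures [rbar <= A]; the length [A - rbar] is still at least [B]. *)
apply/cvgeyPge => B; pose A := rbar + Num.max 0 B.
have rA : rbar <= A by rewrite lerDl le_max lexx.
have A0 := lt_le_trans rbar_gt0 rA.
near=> H.
have hH : H0 < H by near: H; apply: nbhs_pinfty_gt; rewrite num_real.
have EA : energy2 A <= H.
  by near: H; apply: nbhs_pinfty_ge; rewrite num_real.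
(* From [1 <= H] follows [H <= H ^+ 2], so that [energy2 A <= H] suffices. *)
have H1 : 1 <= H by near: H; apply: nbhs_pinfty_ge; rewrite num_real.
apply: (@le_trans _ _ (A - rbar)%:E).
  by rewrite lee_fin /A addrC addKr le_max lexx orbT.
apply: period_ge => //; apply: (le_trans EA).
by rewrite expr2 ler_peMr// (le_trans ler01).
Unshelve. all: by end_near. Qed.

End wire.

Theorem theorem1 (R : realType) (mu0 I0 T1 : R) (I1 : R -> R)
    (mu0_gt0 : 0 < mu0) (I0_gt0 : 0 < I0) (T1_gt0 : 0 < T1)
    (I1_C2 : C2 I1) (I1_periodic : periodic I1 T1)
    (I1_mean0 : \int[lebesgue_measure]_(t in `[0, T1]) I1 t = 0)
    (L pz : R) (L_gt0 : 0 < L) :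
  (forall H H' : R, H0 mu0 I0 L pz < H -> H < H' ->
     (period mu0 I0 L pz H < period mu0 I0 L pz H')%E) /\
  period mu0 I0 L pz H @[H --> +oo] --> +oo%E.
Proof.
split; last exact: period_cvgy.
by move=> H H'; exact: period_lt.
Qed.
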